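(* Let $\Lambda$ be an artin algebra. Then $D_R(\mathfrak{s})\simeq\mathfrak{q}$, where $\mathfrak{s}$ and $\mathfrak{q}$ have arbitrary opposite chiralities; that is, the isomorphism holds both for $\mathfrak{s}$ the injective torsion functor on right $\Lambda$-modules and $\mathfrak{q}$ the cotorsion functor on left $\Lambda$-modules, and for $\mathfrak{s}$ on left $\Lambda$-modules and $\mathfrak{q}$ on right $\Lambda$-modules.
   Context: Definitions are given for $\mathfrak{s}$ on right modules and $\mathfrak{q}$ on left modules; the other case is obtained by replacing $\Lambda$ with $\Lambda^{op}$. Let $\iota:\Lambda\to I$ be the injective envelope of $\Lambda$ as a left $\Lambda$-module. For a right $\Lambda$-module $A$, the injective torsion is $\mathfrak{s}(A):=\ker(1\otimes\iota:A\otimes_\Lambda\Lambda\to A\otimes_\Lambda I)\subseteq A$. For a left $\Lambda$-module $C$, the cotorsion module is $\mathfrak{q}(C):=\mathrm{coker}\big(\mathrm{Hom}_\Lambda(I,C)\to\mathrm{Hom}_\Lambda(\Lambda,C)\big)$ (precomposition with $\iota$), i.e. homomorphisms $\Lambda\to C$ modulo those factoring through injective left modules. A covariant functor $F$ from left $\Lambda$-modules to abelian groups is finitely presented if there is an exact sequence $\mathrm{Hom}(Y,\_)\to\mathrm{Hom}(X,\_)\to F\to0$ for some left modules $X,Y$ (not necessarily finitely presented). $\mathrm{fp}(\mathrm{Mod}(\Lambda^{op}),\mathrm{Ab})$ is the abelian category of such functors, and $(\mathrm{mod}(\Lambda),\mathrm{Ab})$ is the category of additive functors from finitely presented right $\Lambda$-modules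 to abelian groups; $\mathfrak{s}$, which commutes with filtered colimits, is identified with its restriction to finitely presented right modules. The functor $D_A:\mathrm{fp}(\mathrm{Mod}(\Lambda^{op}),\mathrm{Ab})\to(\mathrm{mod}(\Lambda),\mathrm{Ab})$ is the contravariant exact functor, unique up to isomorphism, satisfying $D_A(\mathrm{Hom}(M,\_))=\_\otimes_\Lambda M$ (functorially in $M$) for every left module $M$. It is known that the contravariant functor $D_A$ admits a right adjoint $D_R:(\mathrm{mod}(\Lambda),\mathrm{Ab})\to\mathrm{fp}(\mathrm{Mod}(\Lambda^{op}),\mathrm{Ab})$, a contravariant functor characterized by natural isomorphisms $\mathrm{Hom}(F,D_R(G))\cong\mathrm{Hom}(G,D_A(F))$ for $F\in\mathrm{fp}(\mathrm{Mod}(\Lambda^{op}),\mathrm{Ab})$ and $G\in(\mathrm{mod}(\Lambda),\mathrm{Ab})$. *)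

(* Defs.v *)
From HB Require Import structures.
From mathcomp Require Import all_boot all_algebra.
From mathcomp Require Import boolp.
From mathcomp Require Import freeg.

Set Implicit Arguments.
Unset Strict Implicit.
Unset Printing Implicit Defensive.

Import GRing.Theory.
Local Open Scope ring_scope.
Local Open Scope quotient_scope.

Record category := Category {
  ob :> Type;
  hom : ob -> ob -> Type;
  idm : forall a, hom a a;
  cmp : forall a b c, hom b c -> hom a b -> hom a c;
  cmp1m : forall a b (f : hom a b), cmp (idm b) f = f;
  cmpm1 : forall a b (f : hom a b), cmp f (idm a) = f;
  cmpA : forall a b c d (h : hom c d) (g : hom b c) (f : hom a b),
    cmp h (cmp g f) = cmp (cmp h g) f }.

Arguments hom {_}.
Arguments idm {_}.
Arguments cmp {_ _ _ _}.

Definition iso (C : category) (a b : C) : Prop :=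
  exists (f : hom a b) (g : hom b a), cmp g f = idm a /\ cmp f g = idm b.

Definition op (C : category) : category :=
  {| ob := ob C;
     hom a b := @hom C b a;
     idm a := @idm C a;
     cmp a b c g f := @cmp C c b a f g;
     cmp1m a b f := @cmpm1 C b a f;
     cmpm1 a b f := @cmp1m C b a f;
     cmpA a b c d h g f := esym (@cmpA C d c b a f g h) |}.

Definition full_subcategory (C : category) (P : C -> Prop) : category :=
  {| ob := {a : C | P a};
     hom a b := @hom C (sval a) (sval b);
     idm a := @idm C (sval a);
     cmp a b c := @cmp C (sval a) (sval b) (sval c);
     cmp1m a b := @cmp1m C (sval a) (sval b);
     cmpm1 a b := @cmpm1 C (sval a) (sval b);
     cmpA a b c d := @cmpA C (sval a) (sval b) (sval c) (sval d) |}.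

Record functor (C D : category) := Functor {
  fob :> C -> D;
  fmap : forall a b : C, hom a b -> hom (fob a) (fob b);
  fmap1 : forall a : C, fmap (idm a) = idm (fob a);
  fmapM : forall (a b c : C) (g : hom b c) (f : hom a b),
    fmap (cmp g f) = cmp (fmap g) (fmap f) }.

Arguments fmap {C D} _ {a b}.

Definition comp_functor (C D E : category) (G : functor D E) (F : functor C D) :
  functor C E.
Proof.
refine {| fob := fun a => G (F a); fmap := fun a b f => fmap G (fmap F f) |}.
- by move=> a; rewrite !fmap1.
- by move=> a b c g f; rewrite !fmapM.
Defined.

Record nattrans (C D : category) (F G : functor C D) := NatTrans {
  component :> forall a : C, hom (F a) (G a);
  naturality : forall (a b : C) (f : hom a b),
    cmp (component b) (fmap F f) = cmp (fmap G f) (component a) }.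

Lemma nattrans_ext (C D : category) (F G : functor C D) (s t : nattrans F G) :
  (forall a, s a = t a) -> s = t.
Proof.
case: s t => [s sN] [t tN] /= st.
have {}st : s = t by exact: functional_extensionality_dep.
by subst t; congr NatTrans; exact: Prop_irrelevance.
Qed.

Definition functor_category (C D : category) : category.
Proof.
refine {| ob := functor C D;
          hom := @nattrans C D;
          idm F := @NatTrans C D F F (fun a => idm (F a)) _;
          cmp F G H t s := @NatTrans C D F H (fun a => cmp (t a) (s a)) _ |}.
- by move=> F G s; apply: nattrans_ext => a; rewrite /= cmp1m.
- by move=> F G s; apply: nattrans_ext => a; rewrite /= cmpm1.
- by move=> F G H K u t s; apply: nattrans_ext => a; rewrite /= cmpA.
Unshelve.
- by move=> a b f; rewrite cmp1m cmpm1.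
- by move=> a b f; rewrite -cmpA naturality cmpA naturality cmpA.
Defined.

(* Hom_C(F, DR G) ~ Hom_D(G, DA F), naturally in F and G.  Contravariant
   functors are functors on the opposite category. *)
Definition right_adjoint_contra (C D : category)
    (DA : functor (op C) D) (DR : functor (op D) C) : Prop :=
  exists phi : forall (F : C) (G : D), hom F (DR G) -> hom G (DA F),
    (forall F G, bijective (phi F G)) /\
    (forall (F F' : C) (G G' : D) (u : hom F' F) (v : hom G' G)
        (h : hom F (DR G)),
      phi F' G' (cmp (cmp (@fmap (op D) C DR G G' v) h) u)
      = cmp (cmp (@fmap (op C) D DA F F' u) (phi F G h)) v).

(* A synonym of [{linear U -> V}] carrying the pointwise group structure.  Right
   [R]-modules are left modules over the converse ring, [lmodType R^c]. *)
Definition linhom (R : pzRingType) (U V : lmodType R) := {linear U -> V}.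

Section LinHom.
Context (R : pzRingType).
Implicit Types U V W : lmodType R.

Lemma linhom_ext U V (f g : linhom U V) : f =1 g -> f = g.
Proof.
case: f g => [f [[Df] [Zf]]] [g [[Dg] [Zg]]] /= fg.
have {}fg : f = g by exact: funext.
subst g; by rewrite (Prop_irrelevance Df Dg) (Prop_irrelevance Zf Zg).
Qed.

Section Zmodule.
Context (U V : lmodType R).
Definition linhom_zero : linhom U V := \0.
Definition linhom_opp (f : linhom U V) : linhom U V := \- f.
Definition linhom_add (f g : linhom U V) : linhom U V := f \+ g.

Lemma linhom_addA : associative linhom_add.
Proof. by move=> f g h; apply: linhom_ext => x; rewrite /= addrA. Qed.
Lemma linhom_addC : commutative linhom_add.
Proof. by move=> f g; apply: linhom_ext => x; rewrite /= addrC. Qed.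
Lemma linhom_add0 : left_id linhom_zero linhom_add.
Proof. by move=> f; apply: linhom_ext => x; rewrite /= add0r. Qed.
Lemma linhom_addN : left_inverse linhom_zero linhom_opp linhom_add.
Proof. by move=> f; apply: linhom_ext => x; rewrite /= addNr. Qed.

HB.instance Definition _ := gen_eqMixin (linhom U V).
HB.instance Definition _ := gen_choiceMixin (linhom U V).
HB.instance Definition _ := GRing.isZmodule.Build (linhom U V)
  linhom_addA linhom_addC linhom_add0 linhom_addN.
End Zmodule.

Definition linhom_id U : linhom U U := idfun.
Definition linhom_comp U V W (g : linhom V W) (f : linhom U V) : linhom U W :=
  g \o f.

Definition Mod : category.
Proof.
refine {| ob := lmodType R; hom := @linhom R;
          idm := linhom_id; cmp := linhom_comp |}.
- by move=> U V f; apply: linhom_ext.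
- by move=> U V f; apply: linhom_ext.
- by move=> U V W X h g f; apply: linhom_ext.
Defined.

End LinHom.

Lemma additive_ext (U V : zmodType) (f g : {additive U -> V}) :
  f =1 g -> f = g.
Proof.
case: f g => [f [[Df]]] [g [[Dg]]] /= fg.
have {}fg : f = g by exact: funext.
by subst g; rewrite (Prop_irrelevance Df Dg).
Qed.

Definition Ab : category.
Proof.
refine {| ob := zmodType; hom U V := {additive U -> V};
          idm U := idfun; cmp U V W g f := g \o f |}.
- by move=> U V f; apply: additive_ext.
- by move=> U V f; apply: additive_ext.
- by move=> U V W X h g f; apply: additive_ext.
Defined.

Definition exact (U V W : zmodType) (f : {additive U -> V})
    (g : {additive V -> W}) : Prop :=
  forall y, g y = 0 <-> exists x, f x = y.

Local Notation "{ 'quot' I }" := (@Quotient.quot _ I) : type_scope.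

Section QuotMap.
Context (V W : zmodType) (S : zmodClosed V) (T : zmodClosed W).
Context (f : {additive V -> W}) (fST : {homo f : x / x \in S >-> x \in T}).

Definition quot_map (x : {quot S}) : {quot T} := \pi_{quot T} (f (repr x)).

Lemma quot_map_pi x : quot_map (\pi_{quot S} x) = \pi_{quot T} (f x).
Proof.
apply/eqP; rewrite -Quotient.idealrBE -raddfB; apply: fST.
by rewrite Quotient.idealrBE reprK.
Qed.

Lemma quot_map_zmod_morphism : zmod_morphism quot_map.
Proof.
move=> x y; rewrite -[x]reprK -[y]reprK -pi_is_zmod_morphism !quot_map_pi.
by rewrite raddfB pi_is_zmod_morphism.
Qed.
End QuotMap.

(* [L] and [R] are opposite rings and [o : L -> R] is the anti-isomorphism
   between them, used only through the two instances [R := L^c] and [L := R^c]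
   of the identity map.  A "right [L]-module" is thus an [lmodType R], with
   right action [a . l := o l *: a]. *)
Section Tensor.
Context (L R : pzRingType) (o : L -> R).

Section Group.
Context (A : lmodType R) (M : lmodType L).

Definition free_group := {freeg (A * M)%type / int}.
Definition free_gen (a : A) (m : M) : free_group := << (a, m) >>.

Inductive balanced_relation : free_group -> Prop :=
| BalancedDl a a' m :
    balanced_relation (free_gen (a + a') m - free_gen a m - free_gen a' m)
| BalancedDr a m m' :
    balanced_relation (free_gen a (m + m') - free_gen a m - free_gen a m')
| BalancedM a l m :
    balanced_relation (free_gen (o l *: a) m - free_gen a (l *: m)).

Definition tensor_null : {pred free_group} := fun x =>
  `[< forall S : {pred free_group}, zmod_closed S ->
      (forall y, balanced_relation y -> y \in S) -> x \in S >].

Lemma tensor_null_zmod_closed : zmod_closed tensor_null.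
Proof.
split=> [|x y /asboolP xN /asboolP yN].
  by apply/asboolP => S [S0 _] _.
by apply/asboolP => S SS SR; apply: (SS.2); [apply: xN | apply: yN].
Qed.

HB.instance Definition _ :=
  GRing.isZmodClosed.Build free_group tensor_null tensor_null_zmod_closed.

Definition tensor : zmodType := {quot tensor_null}.
Definition pure_tensor (a : A) (m : M) : tensor :=
  \pi_{quot tensor_null} (free_gen a m).

Lemma tensor_nullR y : balanced_relation y -> y \in tensor_null.
Proof. by move=> yR; apply/asboolP => S _; apply. Qed.

Lemma tensor_pi_eq0 y : balanced_relation y -> \pi_{quot tensor_null} y = 0.
Proof.
move=> /tensor_nullR yN; rewrite -[RHS](pi_zeror (s := {quot tensor_null})).
by apply/eqP; rewrite -Quotient.idealrBE subr0.
Qed.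

Lemma pure_tensorDl a a' m :
  pure_tensor (a + a') m = pure_tensor a m + pure_tensor a' m.
Proof.
apply/eqP; rewrite -subr_eq0 opprD addrA /pure_tensor -!pi_is_zmod_morphism.
by apply/eqP/tensor_pi_eq0/BalancedDl.
Qed.

Lemma pure_tensorDr a m m' :
  pure_tensor a (m + m') = pure_tensor a m + pure_tensor a m'.
Proof.
apply/eqP; rewrite -subr_eq0 opprD addrA /pure_tensor -!pi_is_zmod_morphism.
by apply/eqP/tensor_pi_eq0/BalancedDr.
Qed.

Lemma pure_tensorM a l m :
  pure_tensor (o l *: a) m = pure_tensor a (l *: m).
Proof.
apply/eqP; rewrite -subr_eq0 /pure_tensor -!pi_is_zmod_morphism.
by apply/eqP/tensor_pi_eq0/BalancedM.
Qed.

End Group.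

Arguments tensor_null : clear implicits.

Section Map.
Context (A A' : lmodType R) (M M' : lmodType L).
Context (f : linhom A A') (g : linhom M M').

Definition free_map (x : free_group A M) : free_group A' M' :=
  fglift (fun p : A * M => free_gen (f p.1) (g p.2) : zmodule _) x.

Lemma free_map_zmod_morphism : zmod_morphism free_map.
Proof.
by move=> x y; exact: (@lift_is_additive int (A * M)%type (zmodule _) _ x y).
Qed.

HB.instance Definition _ := GRing.isZmodMorphism.Build
  (free_group A M) (free_group A' M') free_map free_map_zmod_morphism.

Lemma free_map_gen a m : free_map (free_gen a m) = free_gen (f a) (g m).
Proof. by rewrite /free_map /= liftU scale1r. Qed.

Lemma free_map_null :
  {homo free_map : x / x \in tensor_null A M >-> x \in tensor_null A' M'}.
Proof.
move=> x /asboolP xN.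
apply: (xN [pred y | free_map y \in tensor_null A' M']) => [|y].
  by split=> [|u v]; rewrite !inE ?raddf0 ?raddfB ?rpred0 //; apply: rpredB.
rewrite inE; case=> [a a' m|a m m'|a l m].
- rewrite !raddfB /= !free_map_gen linearD.
  exact/tensor_nullR/BalancedDl.
- rewrite !raddfB /= !free_map_gen linearD.
  exact/tensor_nullR/BalancedDr.
- rewrite !raddfB /= !free_map_gen !linearZ.
  exact/tensor_nullR/BalancedM.
Qed.

Definition tensor_map (x : tensor A M) : tensor A' M' :=
  @quot_map _ _ (tensor_null A M) (tensor_null A' M') free_map x.

HB.instance Definition _ :=
  GRing.isZmodMorphism.Build (tensor A M) (tensor A' M') tensor_map
    (quot_map_zmod_morphism free_map_null).

Lemma tensor_map_pure a m :
  tensor_map (pure_tensor a m) = pure_tensor (f a) (g m).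
Proof.
by rewrite /pure_tensor -free_map_gen; exact: (quot_map_pi free_map_null).
Qed.

End Map.

Lemma tensor_additive_ext (A : lmodType R) (M : lmodType L) (W : zmodType)
    (h h' : {additive tensor A M -> W}) :
  (forall a m, h (pure_tensor a m) = h' (pure_tensor a m)) -> h =1 h'.
Proof.
move=> hh' x.
pose q (y : free_group A M) : tensor A M := \pi_{quot tensor_null A M} y.
have qB : zmod_morphism q by exact: pi_is_zmod_morphism.
pose d y := h (q y) - h' (q y).
have dB : zmod_morphism d.
  by move=> y z; rewrite /d qB (raddfB h) (raddfB h') opprD addrACA -opprD.
pose D : {additive free_group A M -> W} :=
  HB.pack d (GRing.isZmodMorphism.Build _ _ d dB).
apply/eqP; rewrite -subr_eq0 -[x]reprK; change (D (repr x) == 0).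
rewrite -[repr x]freeg_sumE raddf_sum big1 // => -[a m] _.
rewrite -[coeff _ _]intz -freegU_mulz raddfMz /= /d.
by rewrite [X in X - _](hh' a m) subrr mul0rz.
Qed.

Lemma tensor_map_id A M x : tensor_map (linhom_id A) (linhom_id M) x = x.
Proof.
move: x; apply: (@tensor_additive_ext _ _ _ (tensor_map _ _) idfun) => a m.
exact: tensor_map_pure.
Qed.

Lemma tensor_map_comp (A A' A'' : lmodType R) (M M' M'' : lmodType L)
    (f' : linhom A' A'') (f : linhom A A')
    (g' : linhom M' M'') (g : linhom M M') x :
  tensor_map (linhom_comp f' f) (linhom_comp g' g) x =
  tensor_map f' g' (tensor_map f g x).
Proof.
move: x; apply: (@tensor_additive_ext _ _ _ (tensor_map _ _)
  (tensor_map f' g' \o tensor_map f g)) => a m.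
by rewrite /= !tensor_map_pure.
Qed.

Lemma tensor_map_addl (A A' : lmodType R) (M M' : lmodType L)
    (f f' : linhom A A') (g : linhom M M') x :
  tensor_map (f + f') g x = tensor_map f g x + tensor_map f' g x.
Proof.
move: x; apply: (@tensor_additive_ext _ _ _ (tensor_map _ _)
  (tensor_map f g \+ tensor_map f' g)) => a m.
by rewrite /= !tensor_map_pure pure_tensorDl.
Qed.

End Tensor.

Arguments tensor {L R} o A M.
Arguments pure_tensor {L R} o {A M} a m.
Arguments tensor_map {L R} o {A A' M M'} f g x.

Definition finitely_presented_module (R : pzRingType) (M : lmodType R) : Prop :=
  exists (m n : nat) (f : linhom 'rV[R]_m 'rV[R]_n) (p : linhom 'rV[R]_n M),
    exact f p /\ forall x, exists v, p v = x.

Definition fpMod (R : pzRingType) : category :=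
  @full_subcategory (Mod R) (@finitely_presented_module R).

Definition additive_functor (R : pzRingType) (G : functor (fpMod R) Ab) :
  Prop :=
  forall (A B : fpMod R) (f g : linhom (sval A) (sval B)) (x : G A),
    @fmap _ _ G A B (f + g) x = @fmap _ _ G A B f x + @fmap _ _ G A B g x.

Definition AddFun (R : pzRingType) : category :=
  @full_subcategory (functor_category (fpMod R) Ab) (@additive_functor R).

Section HomFunctor.
Context (L : pzRingType).

Definition postcomp (X U V : lmodType L) (f : linhom U V) (h : linhom X U) :
  linhom X V := linhom_comp f h.

Lemma postcomp_zmod_morphism X U V f : zmod_morphism (@postcomp X U V f).
Proof. by move=> g h; apply: linhom_ext => x; rewrite /= raddfB. Qed.

HB.instance Definition _ X U V f := GRing.isZmodMorphism.Build
  (linhom X U) (linhom X V) (@postcomp X U V f)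
  (@postcomp_zmod_morphism X U V f).

Definition precomp (X Y U : lmodType L) (g : linhom X Y) (h : linhom Y U) :
  linhom X U := linhom_comp h g.

Lemma precomp_zmod_morphism X Y U g : zmod_morphism (@precomp X Y U g).
Proof. by move=> f h; apply: linhom_ext. Qed.

HB.instance Definition _ X Y U g := GRing.isZmodMorphism.Build
  (linhom Y U) (linhom X U) (@precomp X Y U g)
  (@precomp_zmod_morphism X Y U g).

Definition hom_functor (X : lmodType L) : functor (Mod L) Ab.
Proof.
refine (@Functor (Mod L) Ab (fun U : lmodType L => linhom X U)
  (fun U V f => (@postcomp X U V f : {additive _ -> _})) _ _).
- by move=> U; apply: additive_ext => h; apply: linhom_ext.
- by move=> U V W g f; apply: additive_ext => h; apply: linhom_ext.
Defined.

Definition hom_nattrans (X Y : lmodType L) (g : linhom X Y) :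
  nattrans (hom_functor Y) (hom_functor X).
Proof.
refine (@NatTrans _ _ (hom_functor Y) (hom_functor X)
  (fun U => (@precomp X Y U g : {additive _ -> _})) _).
by move=> U V f; apply: additive_ext => h; apply: linhom_ext.
Defined.

(* Kernels and images in the abelian category fp(Mod, Ab) are computed
   pointwise, so that this is also exactness there. *)
Definition functor_exact (F G H : functor (Mod L) Ab)
    (a : nattrans F G) (b : nattrans G H) : Prop :=
  forall U, exact (a U) (b U).

Definition finitely_presented (F : functor (Mod L) Ab) : Prop :=
  exists (X Y : lmodType L) (a : nattrans (hom_functor Y) (hom_functor X))
      (p : nattrans (hom_functor X) F),
    functor_exact a p /\ forall (U : Mod L) (y : F U), exists h, p U h = y.

Definition fpFun : category :=
  @full_subcategory (functor_category (Mod L) Ab) finitely_presented.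

Lemma hom_functor_fp X : finitely_presented (hom_functor X).
Proof.
pose Z : lmodType L := 'rV[L]_0.
exists X, Z, (hom_nattrans (\0 : linhom X Z)), 
  (@idm (functor_category (Mod L) Ab) (hom_functor X)).
split=> [U y|U y]; last by exists y.
split=> [/= -> | [h <-]]; last by apply: linhom_ext => x; rewrite /= raddf0.
by exists \0; apply: linhom_ext.
Qed.

Definition Hom (X : lmodType L) : fpFun := exist _ _ (hom_functor_fp X).

Definition coyoneda : functor (Mod L) (op fpFun).
Proof.
refine (@Functor (Mod L) (op fpFun) Hom hom_nattrans _ _).
- move=> X; apply: nattrans_ext => U; apply: additive_ext => h.
  exact: linhom_ext.
- move=> X Y Z g f; apply: nattrans_ext => U; apply: additive_ext => h.
  exact: linhom_ext.
Defined.

End HomFunctor.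

Section TensorFunctor.
Context (L R : pzRingType) (o : L -> R).

Definition tensor_functor (M : lmodType L) : functor (fpMod R) Ab.
Proof.
refine (@Functor (fpMod R) Ab (fun A => tensor o (sval A) M)
  (fun A B f => (tensor_map o f (linhom_id M) : {additive _ -> _})) _ _).
- by move=> A; apply: additive_ext => x; exact: tensor_map_id.
- move=> A B C g f; apply: additive_ext => x.
  exact: (tensor_map_comp _ _ (linhom_id M) (linhom_id M)).
Defined.

Lemma tensor_functor_additive M : additive_functor (tensor_functor M).
Proof. by move=> A B f g x; exact: tensor_map_addl. Qed.

Definition Tensor (M : lmodType L) : AddFun R :=
  exist _ _ (@tensor_functor_additive M).

Definition tensor_nattrans (M N : lmodType L) (g : linhom M N) :
  nattrans (tensor_functor M) (tensor_functor N).
Proof.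
refine (@NatTrans _ _ (tensor_functor M) (tensor_functor N)
  (fun A => (tensor_map o (linhom_id (sval A)) g : {additive _ -> _})) _).
move=> A B f; apply: additive_ext => x.
transitivity (tensor_map o f g x).
  by rewrite /= -tensor_map_comp; congr tensor_map; apply: linhom_ext.
by rewrite /= -tensor_map_comp; congr tensor_map; apply: linhom_ext.
Defined.

Definition tensor_embedding : functor (Mod L) (AddFun R).
Proof.
refine (@Functor (Mod L) (AddFun R) Tensor tensor_nattrans _ _).
- move=> M; apply: nattrans_ext => A; apply: additive_ext => x.
  exact: tensor_map_id.
- move=> M N P g f; apply: nattrans_ext => A; apply: additive_ext => x.
  exact: (tensor_map_comp (linhom_id _) (linhom_id _)).
Defined.

Definition exact_contra (D : functor (op (fpFun L)) (AddFun R)) : Prop :=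
  forall (F G H : fpFun L) (a : @hom (fpFun L) F G) (b : @hom (fpFun L) G H),
    functor_exact a b ->
    forall A : fpMod R, exact (@fmap _ _ D H G b A) (@fmap _ _ D G F a A).

Definition is_DA (DA : functor (op (fpFun L)) (AddFun R)) : Prop :=
  exact_contra DA /\
  @iso (functor_category (Mod L) (AddFun R))
    (comp_functor DA (coyoneda L)) tensor_embedding.

End TensorFunctor.

Definition injective_module (L : pzRingType) (I : lmodType L) : Prop :=
  forall (U V : lmodType L) (j : linhom U V) (f : linhom U I),
    injective j -> exists g : linhom V I, forall x, g (j x) = f x.

(* Every submodule [S] meeting the image trivially is trivial. *)
Definition essential (L : pzRingType) (U I : lmodType L) (i : linhom U I) :
  Prop :=
  forall S : {pred I}, submod_closed S ->
    (forall x, i x \in S -> i x = 0) -> forall y, y \in S -> y = 0.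

Definition injective_envelope (L : pzRingType) (U I : lmodType L)
    (i : linhom U I) : Prop :=
  [/\ injective_module I, injective i & essential i].

Section Torsion.
Context (L R : pzRingType) (o : L -> R).
Context (I : lmodType L) (iota : linhom L^o I).

Section Object.
Context (A : lmodType R).

(* ker (A = A (x) L -> A (x) I) as a subgroup of [A], along the identification
   [a |-> a (x) 1] of [A] with [A (x) L]. *)
Definition torsion_sub : {pred A} :=
  fun a => tensor_map o (linhom_id A) iota (pure_tensor o a (1 : L^o)) == 0.

Lemma torsion_sub_zmod_closed : zmod_closed torsion_sub.
Proof.
pose d (a : A) := tensor_map o (linhom_id A) iota (pure_tensor o a (1 : L^o)).
have dD a b : d (a + b) = d a + d b by rewrite /d pure_tensorDl raddfD.
have d0 : d 0 = 0 by apply: (addrI (d 0)); rewrite -dD !addr0.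
have dN a : d (- a) = - d a by apply: (addrI (d a)); rewrite -dD !subrr.
split=> [|a b /eqP aS /eqP bS]; apply/eqP; first exact: d0.
by rewrite -/(d (a - b)) dD dN /d aS bS subrr.
Qed.

HB.instance Definition _ :=
  GRing.isZmodClosed.Build A torsion_sub torsion_sub_zmod_closed.

Record torsion := Torsion {
  torsion_val : A;
  torsionP : torsion_val \in torsion_sub }.

HB.instance Definition _ := [isSub for torsion_val].
HB.instance Definition _ := [Choice of torsion by <:].
HB.instance Definition _ := [SubChoice_isSubZmodule of torsion by <:].

End Object.

Arguments torsion_sub : clear implicits.

Section Map.
Context (A B : lmodType R) (f : linhom A B).

Lemma torsion_map_proof (a : torsion A) : f (torsion_val a) \in torsion_sub B.
Proof.
case: a => a /= /eqP aS; apply/eqP.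
have -> : pure_tensor o (f a) (1 : L^o)
    = tensor_map o f (linhom_id _) (pure_tensor o a (1 : L^o)).
  by rewrite tensor_map_pure.
rewrite -tensor_map_comp.
transitivity (tensor_map o f (linhom_id I)
  (tensor_map o (linhom_id A) iota (pure_tensor o a (1 : L^o)))).
  by rewrite -tensor_map_comp; congr tensor_map; apply: linhom_ext.
by rewrite aS raddf0.
Qed.

Definition torsion_map (a : torsion A) : torsion B :=
  Torsion (torsion_map_proof a).

Lemma torsion_map_zmod_morphism : zmod_morphism torsion_map.
Proof. by move=> a b; apply: val_inj; rewrite /= raddfB. Qed.

HB.instance Definition _ := GRing.isZmodMorphism.Build
  (torsion A) (torsion B) torsion_map torsion_map_zmod_morphism.
End Map.

Definition torsion_functor : functor (fpMod R) Ab.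
Proof.
refine (@Functor (fpMod R) Ab (fun A => torsion (sval A))
  (fun A B f => (@torsion_map (sval A) (sval B) f : {additive _ -> _})) _ _).
- by move=> A; apply: additive_ext => a; apply: val_inj.
- by move=> A B C g f; apply: additive_ext => a; apply: val_inj.
Defined.

Lemma torsion_functor_additive : additive_functor torsion_functor.
Proof. by move=> A B f g a; apply: val_inj. Qed.

Definition inj_torsion : AddFun R := exist _ _ torsion_functor_additive.

Section CoObject.
Context (C : lmodType L).

Definition factors : {pred linhom L^o C} :=
  fun h => `[< exists u : linhom I C, precomp iota u = h >].

Lemma factors_zmod_closed : zmod_closed factors.
Proof.
split=> [|_ _ /asboolP[u <-] /asboolP[v <-]]; apply/asboolP.
  by exists 0; rewrite raddf0.
by exists (u - v); rewrite raddfB.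
Qed.

HB.instance Definition _ :=
  GRing.isZmodClosed.Build (linhom L^o C) factors factors_zmod_closed.

Definition cotorsion : zmodType := {quot factors}.
Definition cotorsion_class (h : linhom L^o C) : cotorsion :=
  \pi_{quot factors} h.

Lemma cotorsion_class_zmod_morphism : zmod_morphism cotorsion_class.
Proof. exact: pi_is_zmod_morphism. Qed.

HB.instance Definition _ := GRing.isZmodMorphism.Build
  (linhom L^o C) cotorsion cotorsion_class cotorsion_class_zmod_morphism.
End CoObject.

Arguments factors : clear implicits.

Section CoMap.
Context (C D : lmodType L) (f : linhom C D).

Lemma postcomp_factors :
  {homo postcomp f : h / h \in factors C >-> h \in factors D}.
Proof.
move=> _ /asboolP[u <-]; apply/asboolP.
by exists (linhom_comp f u); apply: linhom_ext.
Qed.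

Definition cotorsion_map (x : cotorsion C) : cotorsion D :=
  @quot_map _ _ (factors C) (factors D) (postcomp f) x.

HB.instance Definition _ := GRing.isZmodMorphism.Build
  (cotorsion C) (cotorsion D) cotorsion_map
  (quot_map_zmod_morphism postcomp_factors).

Lemma cotorsion_map_class h :
  cotorsion_map (cotorsion_class h) = cotorsion_class (linhom_comp f h).
Proof. exact: (quot_map_pi postcomp_factors). Qed.
End CoMap.

Lemma cotorsion_classP C (x : cotorsion C) : exists h, cotorsion_class h = x.
Proof. by exists (repr x); rewrite /cotorsion_class reprK. Qed.

Definition cotorsion_functor : functor (Mod L) Ab.
Proof.
refine (@Functor (Mod L) Ab cotorsion
  (fun C D f => (cotorsion_map f : {additive _ -> _})) _ _).
- move=> C; apply: additive_ext => x; have [h <-] := cotorsion_classP x.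
  by rewrite /= cotorsion_map_class; congr cotorsion_class; apply: linhom_ext.
- move=> C D E g f; apply: additive_ext => x.
  have [h <-] := cotorsion_classP x.
  by rewrite /= !cotorsion_map_class; congr cotorsion_class; apply: linhom_ext.
Defined.

Lemma cotorsion_functor_fp : finitely_presented cotorsion_functor.
Proof.
unshelve eexists L^o, I, (hom_nattrans iota), (@NatTrans _ _ (hom_functor L^o)
  cotorsion_functor (fun C => (@cotorsion_class C : {additive _ -> _})) _).
  move=> C D f; apply: additive_ext => h.
  by rewrite /= cotorsion_map_class.
split=> [C h|C x]; last exact: cotorsion_classP.
split=> [/= h0|[u <-]].
  have: h \in factors C; last by move/asboolP.
  rewrite -[h]subr0 Quotient.idealrBE; apply/eqP.
  by rewrite [LHS]h0 pi_zeror.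
rewrite -[RHS](pi_zeror (s := {quot factors C})).
apply/eqP; rewrite -Quotient.idealrBE subr0; apply/asboolP.
by exists u.
Qed.

Definition inj_cotorsion : fpFun L := exist _ _ cotorsion_functor_fp.

End Torsion.

Definition artinian (k : comPzRingType) : Prop :=
  forall J : nat -> {pred k^o}, (forall n, submod_closed (J n)) ->
    (forall n, {subset J n.+1 <= J n}) ->
    exists N, forall n, (N <= n)%N -> J n =i J N.

(* Stated with a structure map: an [algType] would exclude the zero ring. *)
Definition artin_algebra (Lam : pzRingType) : Prop :=
  exists (k : comPzRingType) (phi : {rmorphism k -> Lam}),
    [/\ artinian k,
        forall c x, phi c * x = x * phi c &
        exists (n : nat) (e : 'I_n -> Lam), forall x,
          exists c : 'I_n -> k, x = \sum_i phi (c i) * e i].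

(* Main.v *)
Require Import Defs.
From HB Require Import structures.
From mathcomp Require Import all_boot all_algebra.
From mathcomp Require Import boolp classical_sets.
From mathcomp Require Import freeg.

Set Implicit Arguments.
Unset Strict Implicit.
Unset Printing Implicit Defensive.

Import GRing.Theory.
Local Open Scope ring_scope.
Local Open Scope quotient_scope.

(* An essential extension [I] of [L] is finitely presented when [L] is an artin
   [k]-algebra.  Let [W] be a [k]-submodule of [I] maximal with
   [W :&: L = 0].  If [e_1, ..., e_d] generate [L] over [k], then
   [x |-> (e_i x)_i] embeds [I] in [(I / W)^d] by essentiality, and [I / W] is
   an essential extension of [L] over [k].  A finite product of maximal ideals
   of [k] vanishes; if [m] is one of its factors, the elements of [I / W] killed
   by [m] lie in [L], so that climbing along the product shows [I / W] to be
   noetherian.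

   For [I] finitely presented, "[a (x) iota 1 = 0]" amounts to a finite system
   of linear equations, which has a universal solution [(A, a)] with [A] finitely
   presented.  So a transformation from [s] to [_ (x) X] is determined by its
   value at [a]; as this value dies in [A / a R (x) X], it is [a (x) x] for some
   [x], and [a (x) x = 0] iff [x] is the image of [iota 1] under a map from [I]
   to [X].  Hence [Hom(s, _ (x) X) = q X = Hom(Hom(X, _), q)], and presentations
   extend this to [Hom(s, DA F) = Hom(F, q)] for all [F]. *)

(** * Relatively noetherian modules *)

Section Submodules.
Context (K : pzRingType).
Implicit Types Q : lmodType K.

Definition submod Q (S : Q -> Prop) : Prop :=
  S 0 /\ forall c x y, S x -> S y -> S (c *: x + y).

Lemma submod0 Q (S : Q -> Prop) : submod S -> S 0.
Proof. by case. Qed.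

Lemma submodD Q (S : Q -> Prop) x y : submod S -> S x -> S y -> S (x + y).
Proof. by move=> [_ SP] Sx Sy; rewrite -[x]scale1r; apply: SP. Qed.

Lemma submodZ Q (S : Q -> Prop) c x : submod S -> S x -> S (c *: x).
Proof. by move=> [S0 SP] Sx; rewrite -[_ *: _]addr0; apply: SP. Qed.

Lemma submodN Q (S : Q -> Prop) x : submod S -> S x -> S (- x).
Proof. by move=> SS Sx; rewrite -scaleN1r; apply: submodZ. Qed.

Lemma submodB Q (S : Q -> Prop) x y : submod S -> S x -> S y -> S (x - y).
Proof. by move=> SS Sx Sy; apply: submodD => //; apply: submodN. Qed.

Lemma submod_eq0 Q : submod (fun x : Q => x = 0).
Proof. by split=> // c x y -> ->; rewrite scaler0 addr0. Qed.

Lemma submodI Q (S T : Q -> Prop) :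
  submod S -> submod T -> submod (fun x => S x /\ T x).
Proof.
move=> [S0 SS] [T0 TT]; split=> [//|c x y [Sx Tx] [Sy Ty]].
by split; [apply: SS | apply: TT].
Qed.

Lemma submod_preim Q Q' (f : linhom Q Q') (S : Q' -> Prop) :
  submod S -> submod (fun x => S (f x)).
Proof.
move=> [S0 SS]; split=> [|c x y Sx Sy]; first by rewrite raddf0.
by rewrite linearP; apply: SS.
Qed.

Lemma submod_add Q (S T : Q -> Prop) : submod S -> submod T ->
  submod (fun x => exists y z, [/\ S y, T z & x = y + z]).
Proof.
move=> [S0 SS] [T0 TT]; split=> [|c _ _ [y [z [Sy Tz ->]]] [y' [z' [Sy' Tz' ->]]]].
  by exists 0, 0; rewrite addr0.
exists (c *: y + y'), (c *: z + z'); split; [exact: SS | exact: TT |].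
by rewrite scalerDr addrACA.
Qed.

Lemma submod_image Q Q' (f : linhom Q Q') (S : Q -> Prop) :
  submod S -> submod (fun y => exists2 x, S x & y = f x).
Proof.
move=> [S0 SS]; split=> [|c _ _ [x Sx ->] [y Sy ->]].
  by exists 0; rewrite ?raddf0.
by exists (c *: x + y); [apply: SS | rewrite linearP].
Qed.

(** Zorn's lemma on the submodules that contain [U] and miss [X]. For [W] maximal and [x] outside
    [W], the submodule [W + K x] is strictly larger, so it must meet [X]. *)
Lemma exists_max_disjoint Q (X U : Q -> Prop) :
  submod U -> (forall x, U x -> ~ X x) ->
  exists W : Q -> Prop, [/\ submod W, forall x, U x -> W x,
    forall x, W x -> ~ X x &
    forall x, ~ W x -> exists c w, W w /\ X (w + c *: x)].
Proof.
move=> SU UX.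
pose good (S : Q -> Prop) :=
  [/\ submod S, forall x, U x -> S x & forall x, S x -> ~ X x].
pose P (S : set Q) := good S \/ forall x, ~ S x.
have [F FP tF|W [PW maxW]] := @Zorn_bigcup Q P.
  have [[S0 FS0 [x0 S0x0]]|noS] :=
    pselect (exists2 S, F S & exists x, S x); last first.
    by right=> x [S FS Sx]; apply: noS; exists S => //; exists x.
  have goodF S x : F S -> S x -> good S.
    by move=> FS Sx; case: (FP S FS) => // /(_ x).
  have [[S00 _] US0 _] := goodF _ _ FS0 S0x0.
  left; split=> [|x Ux|x [S FS Sx]]; last by have [_ _] := goodF _ _ FS Sx; apply.
  - split; first by exists S0.
    move=> c x y [S FS Sx] [T FT Ty].
    have [ST|TS] := tF _ _ FS FT.
      exists T => //; have [[_ TT] _ _] := goodF _ _ FT Ty.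
      by apply: TT => //; apply: ST.
    exists S => //; have [[_ SS] _ _] := goodF _ _ FS Sx.
    by apply: SS => //; apply: TS.
  - by exists S0 => //; apply: US0.
have gW : good W.
  case: PW => // W0; exfalso; apply: (maxW (U : set Q)); last by left.
  split=> [x /W0 //|UW]; exact: (W0 0 (UW 0 (submod0 SU))).
have [SW UW WX] := gW.
exists W; split=> // x nWx; apply: contrapT => nX.
pose W' : set Q := fun z => exists w c, W w /\ z = w + c *: x.
apply: (maxW W').
  split=> [w Ww|W'W]; first by exists w, 0; rewrite scale0r addr0.
  apply: nWx; apply: W'W; exists 0, 1; rewrite scale1r add0r; split=> //.
  exact: submod0.
left; split.
- split; first by exists 0, 0; rewrite scale0r addr0; split=> //; apply: submod0.
  move=> c _ _ [w [d [Ww ->]]] [w' [d' [Ww' ->]]].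
  exists (c *: w + w'), (c * d + d'); split; first by apply: SW.2.
  by rewrite scalerDr scalerDl scalerA addrACA.
- by move=> w /UW Ww; exists w, 0; rewrite scale0r addr0.
- by move=> _ [w [c [Ww ->]]] Xw; apply: nX; exists c, w.
Qed.

(** Finite generation of [(T + W) / W] by classes of elements of [T], phrased without forming the
    quotient. *)
Definition fg_mod Q (W T : Q -> Prop) : Prop :=
  exists2 s : seq Q, forall x, x \in s -> T x &
    forall S, submod S -> (forall x, W x -> S x) -> (forall x, x \in s -> S x) ->
    forall x, T x -> S x.

(* [(S + W) / W] is noetherian; [W] need not be contained in [S]. *)
Definition noeth_mod Q (W S : Q -> Prop) : Prop :=
  forall T, submod T -> (forall x, T x -> S x) -> fg_mod W T.

Lemma noeth_modS Q (W S S' : Q -> Prop) :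
  (forall x, S' x -> S x) -> noeth_mod W S -> noeth_mod W S'.
Proof. by move=> S'S nS T ST TS'; apply: nS => // x /TS'/S'S. Qed.

Lemma seq_choice (X Y : eqType) (P : X -> Y -> Prop) (s : seq X) :
  (forall x, x \in s -> exists y, P x y) ->
  exists t : seq Y, (forall x, x \in s -> exists2 y, y \in t & P x y) /\
    (forall y, y \in t -> exists2 x, x \in s & P x y).
Proof.
elim: s => [|x s IHs] sP; first by exists [::].
have [|t [st ts]] := IHs; first by move=> z zs; apply: sP; rewrite inE zs orbT.
have [|y xy] := sP x; first by rewrite mem_head.
exists (y :: t); split=> z; rewrite inE => /predU1P[->|].
- by exists y; rewrite ?mem_head.
- by move=> /st[u ut zu]; exists u; rewrite // inE ut orbT.
- by exists x; rewrite ?mem_head.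
- by move=> /ts[u us zu]; exists u; rewrite // inE us orbT.
Qed.

(** The usual extension argument: a submodule [T] of [S] is generated modulo [W] by lifts of
    generators of [f(T)] modulo [W'], together with generators modulo [W] of the part of [T] that
    [f] sends into [W']. *)
Lemma noeth_mod_ext Q Q' (f : linhom Q Q') (S W : Q -> Prop)
    (S' W' : Q' -> Prop) :
  submod W' ->
  (forall x, S x -> S' (f x)) -> noeth_mod W' S' ->
  noeth_mod W (fun x => S x /\ W' (f x)) -> noeth_mod W S.
Proof.
move=> SW' SS' nS' nS T ST TS.
have [|s' s'T s'P] := nS' _ (submod_image f ST).
  by move=> _ [x Tx ->]; apply/SS'/TS.
have [s1 [s's1 s1s']] := seq_choice (P := fun y x => T x /\ y = f x)
  (fun y ys => let: ex_intro2 x Tx e := s'T y ys in ex_intro _ x (conj Tx e)).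
have [||s2 s2T s2P] := nS (fun x => T x /\ W' (f x)).
- by apply: submodI => //; apply: submod_preim.
- by move=> x [/TS ? ?].
exists (s1 ++ s2) => [x|Z SZ WZ sZ].
  by rewrite mem_cat => /orP[/s1s'[? _ []]|/s2T[]].
have {}s2P : forall x, T x -> W' (f x) -> Z x.
  move=> x Tx Wx; apply: s2P => // y ys2; apply: sZ.
  by rewrite mem_cat ys2 orbT.
(* The generation property is applied to [f(Z ∩ T) + W']. Keeping [z] in [T] as well as in [Z] makes
   [t - z] an element of [T] with image in [W']. *)
move=> t Tt; have := s'P (fun y => exists a b, [/\
  exists2 z, Z z /\ T z & a = f z, W' b & y = a + b]).
have Tft : exists2 x, T x & f t = f x by exists t.
move=> /(_ _ _ _ _ Tft) ftP; case: ftP.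
- by apply: submod_add => //; apply: submod_image; apply: submodI.
- move=> y W'y; exists 0, y; split=> //; last by rewrite add0r.
  by exists 0; rewrite ?raddf0 //; split; apply: submod0.
- move=> y /s's1[x xs1 [Tx ->]]; exists (f x), 0; split; last by rewrite addr0.
    by exists x => //; split=> //; apply: sZ; rewrite mem_cat xs1.
  exact: submod0.
move=> _ [b [[z [Zz Tz] ->] W'b ft]].
rewrite -[t](subrK z); apply: submodD => //; apply: s2P; first exact: submodB.
have -> : f (t - z) = f t - f z by exact: raddfB.
by rewrite ft addrC addKr.
Qed.

Lemma noeth_mod_trans Q (W V S : Q -> Prop) :
  submod V -> noeth_mod W V -> noeth_mod V S -> noeth_mod W S.
Proof.
move=> SV nV nS; apply: (noeth_mod_ext (f := linhom_id Q) SV _ nS) => //.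
by apply: noeth_modS nV => x [].
Qed.

(** Modulo their joint kernel, the maps in [fs] embed [S] into a finite power of [Q' / W']; the maps
    are treated one at a time. *)
Lemma noeth_mod_exts Q Q' (fs : seq (linhom Q Q')) (S W : Q -> Prop)
    (S' W' : Q' -> Prop) :
  submod W' ->
  (forall f x, f \in fs -> S x -> S' (f x)) -> noeth_mod W' S' ->
  noeth_mod W (fun x => S x /\ forall f, f \in fs -> W' (f x)) ->
  noeth_mod W S.
Proof.
move=> SW'; elim: fs S => [|f fs IHfs] S SS' nS' nS.
  by apply: noeth_modS nS => x Sx; split.
apply: (noeth_mod_ext SW' _ nS') => [x|]; first exact/SS'/mem_head.
apply: IHfs => // [g x gfs [Sx _]|]; first by apply: SS'; rewrite // inE gfs orbT.
apply: noeth_modS nS => x [[Sx fx] fsx]; split=> // g.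
by rewrite inE => /predU1P[->|/fsx].
Qed.

(** [(W + M) / W] is a quotient of [M]. Generators of [M ∩ (W + T)] are moved into [T] by
    subtracting elements of [W]. *)
Lemma noeth_mod_add Q (W M : Q -> Prop) : submod W -> submod M ->
  noeth_mod (fun x => x = 0) M ->
  noeth_mod W (fun x => exists w v, [/\ W w, M v & x = w + v]).
Proof.
move=> SW SM nM T ST TWM.
have ST' := submodI SM (submod_add SW ST).
have [x []//|s' s'T s'P] := nM _ ST'.
have [x /s'T[Mx [w [t [Ww Tt xE]]]]|s [s's ss']] :=
  @seq_choice _ _ (fun v t => T t /\ W (v - t)) s'.
  by exists t; rewrite xE addrK.
exists s => [x /ss'[_ _ []]//|Z SZ WZ sZ t Tt].
have [w [v [Ww Mv tE]]] := TWM t Tt.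
rewrite tE; apply: submodD => //; first exact: WZ.
apply: s'P => // [_ ->|x /s's[y ys [_ Wxy]]|]; first exact: submod0.
  by rewrite -[x](subrK y); apply: submodD => //; [apply: WZ | apply: sZ].
by split=> //; exists (- w), t; split=> //; [exact: submodN | rewrite tE addKr].
Qed.

Lemma noeth_mod_image Q Q' (f : linhom Q Q') (S : Q -> Prop) :
  submod S -> noeth_mod (fun x => x = 0) S ->
  noeth_mod (fun x => x = 0) (fun y => exists2 x, S x & y = f x).
Proof.
move=> SS nS T ST TfS.
have [||s sP sT] := nS (fun x => S x /\ T (f x)).
- by apply: submodI => //; apply: submod_preim.
- by move=> x [].
exists (map f s) => [_ /mapP[x /sP[_ Tx] ->] //|Z SZ Z0 sZ y Ty].
have [x Sx yE] := TfS y Ty; rewrite yE.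
apply: (sT _ (submod_preim f SZ)) => [_ ->|z zs|]; last by rewrite -yE.
- by rewrite raddf0; apply: Z0.
- by apply/sZ/map_f.
Qed.

Definition span_seq Q (s : seq Q) : Q -> Prop := fun x =>
  forall S, submod S -> (forall y, y \in s -> S y) -> S x.

Lemma submod_span Q (s : seq Q) : submod (span_seq s).
Proof.
split=> [S SS _|c x y xs ys S SS sS]; first exact: submod0.
by apply: SS.2; [apply: xs | apply: ys].
Qed.

Lemma mem_span Q (s : seq Q) x : x \in s -> span_seq s x.
Proof. by move=> xs S _; apply. Qed.

Definition scale_hom Q (x : Q) : K^o -> Q := fun c => (c : K) *: x.
Lemma scale_hom_linear Q x : linear (@scale_hom Q x).
Proof. by move=> c a b; rewrite /scale_hom scalerDl scalerA. Qed.
HB.instance Definition _ Q x :=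
  GRing.isLinear.Build K K^o Q _ (@scale_hom Q x) (scale_hom_linear x).

(** Each new generator [x] adds the cyclic module [K x], an image of the noetherian module [K]. *)
Lemma noeth_span Q (s : seq Q) :
  noeth_mod (fun x : K^o => x = 0) (fun=> True) ->
  noeth_mod (fun x => x = 0) (span_seq s).
Proof.
move=> nK; elim: s => [|x s IHs].
  move=> T ST Ts; exists [::] => [//|S SS S0 _ y /Ts yT].
  by apply: S0; apply: (yT _ (@submod_eq0 Q)).
apply: (noeth_mod_trans (@submod_span Q s)) => //.
have TT : submod (fun _ : K^o => True) by split.
have := noeth_mod_add (@submod_span Q s)
  (submod_image (scale_hom x : linhom _ _) TT) (noeth_mod_image TT nK).
apply: noeth_modS => y ys.
apply: (ys _ (submod_add (submod_span s)
  (submod_image (scale_hom x : linhom _ _) TT))) => z.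
rewrite inE => /predU1P[->|zs].
  exists 0, x; rewrite add0r; split=> //; first exact: (submod_span s).1.
  by exists 1; rewrite //= /scale_hom scale1r.
exists z, 0; rewrite addr0; split=> //; first exact: mem_span.
by exists 0; rewrite //= /scale_hom scale0r.
Qed.

End Submodules.

(** * Commutative artinian rings *)

Section ArtinianRing.
Context (k : comPzRingType).
Implicit Types (m S T : k^o -> Prop) (ms : seq (k^o -> Prop)).

Lemma idealM S (c p : k) : submod S -> S p -> S (c * p).
Proof. exact: (@submodZ k k^o S c p). Qed.

(* The unit ideal counts as maximal, which is harmless here. *)
Definition maximal_ideal m : Prop :=
  submod m /\ forall c : k, m c \/ exists d : k, m (1 - d * c).

Fixpoint ideal_prod ms : k^o -> Prop :=
  if ms is m :: ms' then fun x =>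
    forall S, submod S -> (forall c p : k, m c -> ideal_prod ms' p -> S (c * p)) -> S x
  else fun=> True.

Fixpoint all_maximal ms : Prop :=
  if ms is m :: ms' then maximal_ideal m /\ all_maximal ms' else True.

Lemma submod_ideal_prod ms : submod (ideal_prod ms).
Proof.
case: ms => [|m ms] //=.
split=> [S SS _|c x y xP yP S SS SP]; first exact: submod0.
by apply: SS.2; [apply: xP | apply: yP].
Qed.

Lemma ideal_prod_cons m ms (c p : k) :
  m c -> ideal_prod ms p -> ideal_prod (m :: ms) (c * p).
Proof. by move=> mc pP S SS; apply. Qed.

Lemma ideal_prodS m ms x : ideal_prod (m :: ms) x -> ideal_prod ms x.
Proof.
apply; first exact: submod_ideal_prod.
by move=> c p _; apply: idealM; exact: submod_ideal_prod.
Qed.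

Hypothesis artin_k : artinian k.

(** Without a minimal member, choice provides a strictly smaller member [next S] for each [S] in
    [F], and iterating [next] contradicts the descending chain condition. *)
Lemma artinian_min (F : (k^o -> Prop) -> Prop) S0 :
  F S0 -> (forall S, F S -> submod S) ->
  exists2 S, F S & forall T, F T -> (forall x, T x -> S x) ->
    forall x, S x -> T x.
Proof.
move=> FS0 FS; apply: contrapT => noMin.
have /choice[next nextP] : forall S, exists T, F S ->
    [/\ F T, forall x, T x -> S x & exists2 x, S x & ~ T x].
  move=> S; have [FS'|nFS] := pselect (F S); last by exists S.
  apply: contrapT => noT; apply: noMin; exists S => // T FT TS x Sx.
  by apply: contrapT => nTx; apply: noT; exists T => _; split=> //; exists x.
pose J n := iter n next S0.
have FJ n : F (J n) by elim: n => //= n /nextP[].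
have [n|n x|N NP] := @artin_k (fun n => [pred x | `[< J n x >]]).
- have [J0 JJ] := FS _ (FJ n); split=> [|c x y /asboolP Jx /asboolP Jy].
    exact/asboolP.
  by apply/asboolP; apply: JJ.
- by move=> /asboolP Jx; apply/asboolP; have [_ + _] := nextP _ (FJ n); apply.
have [_ _ [x Jx nJx]] := nextP _ (FJ N).
have := NP N.+1 (leqnSn N) x; rewrite !inE => E.
by apply: nJx; change (J N.+1 x); apply/asboolP; rewrite E; apply/asboolP.
Qed.

(** Let [P] be a minimal product of maximal ideals. If [P] is nonzero, take [T] minimal with [P T]
    nonzero, and [t] in [T] with [P t] nonzero. Let [m] be the annihilator of [P t]. For [c] outside
    [m], minimality of [T] gives [t = d c t] for some [d], so that [1 - d c] lies in [m]: thus [m]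
    is maximal. *)
Lemma ideal_prod_eq0 : exists2 ms, all_maximal ms &
  forall x, ideal_prod ms x -> x = 0.
Proof.
pose F S := exists2 ms, all_maximal ms &
  S = ideal_prod ms.
have [|S [ms _ ->]|_ [ms max_ms ->] minP] := @artinian_min F (fun=> True).
- by exists [::].
- exact: submod_ideal_prod.
exists ms => // p0 Pp0; apply: contrapT => p0N0.
pose F' T := submod T /\ exists p t : k, [/\ ideal_prod ms p, T t & p * t <> 0].
have [|T []//|T [ST [p [t [Pp Tt pt]]]] minT] := @artinian_min F' (fun=> True).
  by split=> //; exists p0, 1; rewrite mulr1.
pose m (c : k^o) := forall q : k, ideal_prod ms q -> (c : k) * q * t = 0.
have max_m : maximal_ideal m.
  split=> [|c].
    split=> [q _|c x y xq yq q qP]; first by rewrite !mul0r.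
    rewrite !mulrDl yq // addr0; change (c * x * q * t = 0).
    by rewrite -2!mulrA [x * _]mulrA xq ?mulr0.
  have [mc|nmc] := pselect (m c); [by left | right].
  have [q qP qct] : exists2 q : k, ideal_prod ms q & c * q * t <> 0.
    apply: contrapT => noq; apply: nmc => q qP; apply: contrapT => qct.
    by apply: noq; exists q.
  have [|x [d _ ->]|d _ tE] := minT (fun x =>
    exists2 d : k^o, True & x = scale_hom (c * t : k^o) d) _ _ t Tt.
  - split; first exact: (submod_image (scale_hom (c * t : k^o) : linhom _ _)).
    exists q, (c * t); split=> //; first by exists 1; rewrite //= /scale_hom scale1r.
    by rewrite mulrCA mulrA.
  - by rewrite /scale_hom /= /GRing.scale /= mulrA; apply: idealM.
  exists d => u uP; have {}tE : t = d * (c * t) by [].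
  by rewrite -mulrA mulrCA mulrBl mul1r -[d * c * t]mulrA -tE subrr mulr0.
(* Minimality of [P] gives [P = m P], whence [P t = m P t = 0], a contradiction. *)
have mPP : forall x, ideal_prod ms x -> ideal_prod (m :: ms) x.
  apply: minP => [|x /ideal_prodS //].
  by exists (m :: ms).
apply: pt.
apply: (mPP p Pp (fun x : k^o => (x : k) * t = 0)) => [|c q mc Pq]; last exact: mc.
split=> [|c x y xt yt]; first by rewrite mul0r.
rewrite mulrDl yt addr0; change (c * x * t = 0).
by rewrite -mulrA xt mulr0.
Qed.

(** Outside [m], the scalar [c] is invertible modulo [m], and [m] acts as zero on [x] modulo [W]. *)
Lemma maximal_ideal_cancel (Q : lmodType k) (W : Q -> Prop) m c x :
  maximal_ideal m -> ~ m c -> submod W -> (forall d : k, m d -> W (d *: x)) ->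
  W (c *: x) -> W x.
Proof.
move=> [_ /(_ c)[//|[d mdc]]] _ SW mx Wcx.
have -> : x = d *: (c *: x) + (1 - d * c) *: x.
  by rewrite scalerBl scale1r scalerA addrC subrK.
by apply: submodD => //; [apply: submodZ | apply: mx].
Qed.

(** [S / U] is an artinian vector space over [k / m], hence of finite dimension. Take [W] minimal
    between [U] and [S] with [S] finitely generated modulo [W]. If [w] lies in [W] but not in [U],
    and [W'] is maximal among the ideals containing [U] and avoiding [w], then [W' ∩ W] is strictly
    smaller than [W] and still qualifies. *)
Lemma artinian_fg m S U : maximal_ideal m -> submod S -> submod U ->
  (forall x, U x -> S x) -> (forall (c : k) x, m c -> S x -> U (c *: x)) ->
  fg_mod U S.
Proof.
move=> max_m SS SU US mSU.
pose F W := [/\ submod W, forall x, U x -> W x, forall x, W x -> S x & fg_mod W S].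
have [|W []//|W [SW UW WS [s sS sP]] minW] := @artinian_min F S.
  by split=> //; exists [::] => // Z _ SZ _ x /SZ.
suff WU : forall x, W x -> U x.
  by exists s => // Z SZ UZ sZ x Sx; apply: (sP Z) => // y /WU/UZ.
move=> w Ww; apply: contrapT => nUw.
have [x Ux xw|W' [SW' UW' nW'w maxW']] := exists_max_disjoint (X := eq w) SU.
  by apply: nUw; rewrite xw.
apply: (nW'w w) => //; suff [] : W' w /\ W w by [].
apply: (minW (fun x => W' x /\ W x)) => [|x []//|//].
split=> [|x Ux|x [_ /WS]//|]; first exact: submodI.
  by split; [apply: UW' | apply: UW].
exists (w :: s) => [x|Z SZ W'Z sZ].
  by rewrite inE => /predU1P[->|/sS //]; apply: WS.
apply: sP => // [v Wv|x xs]; last by apply: sZ; rewrite inE xs orbT.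
have [W'v|nW'v] := pselect (W' v); first exact: W'Z.
(* Maximality of [W'] writes [w = w' + c v]. Here [c] is outside [m], since otherwise [c v] would be
   in [U] and [w] in [W']; so [v] can be recovered from [w] modulo [W' ∩ W]. *)
have [c [w' [W'w' wE]]] := maxW' v nW'v.
have Ww' : W w'.
  by rewrite -[w'](addrK (c *: v)) -wE; apply: submodB => //; apply: submodZ.
have nmc : ~ m c.
  move=> mc; apply: (nW'w w) => //; rewrite wE; apply: submodD => //.
  by apply/UW'/mSU => //; apply: WS.
apply: (maximal_ideal_cancel max_m nmc SZ) => [d md|].
  by apply: W'Z; split; [apply/UW'/mSU => //; apply: WS | apply: submodZ].
rewrite -[_ *: _](addKr w') -wE; apply: submodD => //; last exact/sZ/mem_head.
by apply: submodN => //; apply: W'Z.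
Qed.

(** The partial products of a vanishing product of maximal ideals filter [k], and each successive
    quotient is killed by one maximal ideal. *)
Lemma artinian_noeth : noeth_mod (fun x : k^o => x = 0) (fun=> True).
Proof.
have [ms max_ms ms0] := ideal_prod_eq0.
suff nms : noeth_mod (ideal_prod ms) (fun=> True).
  move=> T ST TT; have [s sT sP] := nms T ST TT.
  by exists s => // S SS S0 sS; apply: sP => // x /ms0; apply: S0.
elim: ms max_ms {ms0} => [_ T ST _|m ms IHms [max_m /IHms {}IHms]].
  by exists [::] => // S SS S1 _ x _; apply: S1.
apply: (noeth_mod_trans (submod_ideal_prod ms) _ IHms) => T ST TP.
have [||c x mc Tx|s sT sP] :=
  @artinian_fg m T (fun x => T x /\ ideal_prod (m :: ms) x) max_m ST.
- exact: submodI (submod_ideal_prod (m :: ms)).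
- by move=> x [].
- split; [exact: submodZ | exact: (ideal_prod_cons mc (TP x Tx))].
by exists s => // S SS mS sS; apply: sP => // x [_ /mS].
Qed.

End ArtinianRing.

(** * Essential extensions of an artin algebra *)

Lemma submod_sum (K : pzRingType) (Q : lmodType K) (S : Q -> Prop)
    (J : Type) (r : seq J) (F : J -> Q) :
  submod S -> (forall j, S (F j)) -> S (\sum_(j <- r) F j).
Proof.
move=> SS SF; elim: r => [|j r IHr]; first by rewrite big_nil; apply: submod0.
by rewrite big_cons; apply: submodD.
Qed.

Section LinearCombination.
Context (L : pzRingType) (V : lmodType L) (n : nat) (v : 'I_n -> V).

Definition lincomb (d : 'rV[L]_n) : V := \sum_j d 0 j *: v j.

Lemma lincomb_linear : linear lincomb.
Proof.
move=> c d d'; rewrite /lincomb scaler_sumr -big_split; apply: eq_bigr => j _.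
by rewrite !mxE scalerDl scalerA.
Qed.

HB.instance Definition _ :=
  GRing.isLinear.Build L 'rV[L]_n V _ lincomb lincomb_linear.

Lemma lincomb_delta j : lincomb (delta_mx 0 j) = v j.
Proof.
rewrite /lincomb (bigD1 j) //= mxE !eqxx scale1r big1 ?addr0 // => i iNj.
by rewrite mxE eqxx (negPf iNj) scale0r.
Qed.

End LinearCombination.

Lemma linhom_lincomb (L : pzRingType) (V V' : lmodType L) (f : linhom V V') n
    (v : 'I_n -> V) d : f (lincomb v d) = lincomb (fun j => f (v j)) d.
Proof. by rewrite /lincomb linear_sum; apply: eq_bigr => j _; rewrite linearZ_LR. Qed.

Section Scaling.
Context (k : comPzRingType) (Q : lmodType k) (c : k).
Definition scaling (x : Q) : Q := c *: x.
Lemma scaling_linear : linear scaling.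
Proof. by move=> d x y; rewrite /scaling scalerDr !scalerA mulrC. Qed.
HB.instance Definition _ := GRing.isLinear.Build k Q Q _ scaling scaling_linear.
End Scaling.

(** An alias recording [phi] in the type, so that the [k]-module structure can be attached to it
    apart from the [L]-module structure of [V]. *)
Definition restr_scalars (k L : pzRingType) (phi : {rmorphism k -> L})
  (V : lmodType L) : Type := V.

Section RestrictionOfScalars.
Context (k : comPzRingType) (L : pzRingType) (phi : {rmorphism k -> L}).
Local Notation restr := (restr_scalars phi).

HB.instance Definition _ (V : lmodType L) := GRing.Zmodule.on (restr V).

Section Lmodule.
Context (V : lmodType L).
Definition restr_scale (c : k) (x : restr V) : restr V := phi c *: (x : V).

Lemma restr_scaleA a b x : restr_scale a (restr_scale b x) = restr_scale (a * b) x.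
Proof. by rewrite /restr_scale scalerA rmorphM. Qed.
Lemma restr_scale1 : left_id 1 restr_scale.
Proof. by move=> x; rewrite /restr_scale rmorph1 scale1r. Qed.
Lemma restr_scaleDr : right_distributive restr_scale +%R.
Proof. by move=> c x y; apply: scalerDr. Qed.
Lemma restr_scaleDl x : {morph restr_scale^~ x : a b / a + b}.
Proof. by move=> a b; rewrite /restr_scale rmorphD scalerDl. Qed.

HB.instance Definition _ := GRing.Zmodule_isLmodule.Build k (restr V)
  restr_scaleA restr_scale1 restr_scaleDr restr_scaleDl.
End Lmodule.

Lemma restr_scaleE (V : lmodType L) c (x : restr V) : c *: x = phi c *: (x : V).
Proof. by []. Qed.

Lemma submod_restr (V : lmodType L) (S : V -> Prop) :
  submod S -> submod (S : restr V -> Prop).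
Proof. by case=> S0 SS; split=> // c x y Sx Sy; apply: SS. Qed.

Section Linear.
Context (U V : lmodType L) (f : linhom U V).
Definition restr_map : restr U -> restr V := f.
Lemma restr_map_linear : linear restr_map.
Proof. by move=> c x y; rewrite /restr_map restr_scaleE linearP. Qed.
HB.instance Definition _ :=
  GRing.isLinear.Build k (restr U) (restr V) _ restr_map restr_map_linear.
End Linear.

Hypothesis phi_central : forall c x, phi c * x = x * phi c.

Section Homothety.
Context (V : lmodType L) (l : L).
Definition homothety (x : restr V) : restr V := l *: (x : V).
Lemma homothety_linear : linear homothety.
Proof.
move=> c x y; rewrite /homothety scalerDr; congr (_ + _).
by rewrite !restr_scaleE !scalerA phi_central.
Qed.
HB.instance Definition _ :=
  GRing.isLinear.Build k (restr V) (restr V) _ homothety homothety_linear.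
End Homothety.


Context (n : nat) (e : 'I_n -> L).
Hypothesis e_gen : forall x, exists c : 'I_n -> k, x = \sum_i phi (c i) * e i.
Hypothesis artin_k : artinian k.

(** The products [e i *: v j] generate [V] over [k], which is noetherian. *)
Lemma noeth_restr (V : lmodType L) (p : nat) (v : 'I_p -> V) :
  (forall x, exists d, lincomb v d = x) ->
  noeth_mod (fun x : restr V => x = 0) (fun=> True).
Proof.
move=> v_gen.
pose s : seq (restr V) := [seq e ij.1 *: v ij.2 | ij : 'I_n * 'I_p].
have := @noeth_span _ _ s (artinian_noeth artin_k).
apply: noeth_modS => x _.
have Ss := @submod_span k (restr V) s.
have [d <-] := v_gen x.
apply: (submod_sum (S := span_seq s)) => // j.
have [c ->] := e_gen (d 0 j); rewrite scaler_suml.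
apply: (submod_sum (S := span_seq s)) => // i.
rewrite -scalerA; apply: (@submodZ k (restr V) (span_seq s) (c i) (e i *: v j) Ss).
by apply: mem_span; apply/mapP; exists (i, j); rewrite ?mem_enum.
Qed.

Section Essential.
Context (I : lmodType L) (iota : linhom L^o I).
Hypothesis iota_ess : essential iota.

Let M : restr I -> Prop :=
  fun y => exists2 x : restr L^o, True & y = restr_map iota x.

Let submod_M : submod M.
Proof. by apply: (submod_image (restr_map iota : linhom _ _)); split. Qed.

Let noeth_M : noeth_mod (fun x => x = 0) M.
Proof.
apply: (noeth_mod_image (f := restr_map iota : linhom _ _)); first by split.
apply: (@noeth_restr L^o 1 (fun=> 1)) => x; exists (const_mx x).
by rewrite /lincomb big_ord1 mxE [RHS](esym (mulr1 x)).
Qed.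

(* [W] is maximal among the [k]-submodules meeting [iota L] trivially, so that
   [I / W] is an essential extension of [L] over [k]. *)
Lemma noeth_essential_mod (W : restr I -> Prop) : submod W ->
  (forall x, W x -> ~ (M x /\ x <> 0)) ->
  (forall x, ~ W x -> exists c w, W w /\ (M (w + c *: x) /\ w + c *: x <> 0)) ->
  noeth_mod W (fun=> True).
Proof.
move=> SW WM maxW; have [ms max_ms ms0] := ideal_prod_eq0 artin_k.
(* [A ms] consists of the elements sent into [W] by the product [ms]: it is [W] for the empty
   product and all of [I] for a vanishing one. *)
pose A ms (x : restr I) := forall p : k, ideal_prod ms p -> W (p *: x).
suff : noeth_mod W (A ms).
  by apply: noeth_modS => x _ p /ms0 ->; rewrite scale0r; apply: submod0.
elim: ms max_ms {ms0} => [_ T ST TA|m ms IHms [max_m /IHms {}IHms]].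
  by exists [::] => // S SS WS _ x /TA /(_ 1 Logic.I); rewrite scale1r; apply: WS.
(* Multiplications by the finitely many generators of [m] map [A (m :: ms)] to [A ms]; modulo [W],
   their joint kernel consists of the [x] with [m x] inside [W]. *)
have [|s sm mP] := artinian_noeth artin_k (proj1 max_m); first by [].
apply: (noeth_mod_exts
    (fs := [seq (scaling (g : k) : linhom (restr I) (restr I)) | g <- s]) SW _ IHms).
  move=> _ x /mapP[g gs ->] Ax p Pp; rewrite /= /scaling scalerA mulrC.
  have gpP := ideal_prod_cons (sm g gs) Pp.
  exact: (Ax _ gpP).
(* Such an [x] lies in [W + M]. If it is not in [W], some [w + c x] is a nonzero element of [M];
   then [c] is outside [m], for otherwise this element would be in [W] too, and [c] can be
   cancelled. *)
apply: noeth_modS (noeth_mod_add SW submod_M noeth_M) => x [_ gW].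
have mW c : m c -> W ((c : k) *: x).
  apply: (mP (fun c : k^o => W ((c : k) *: x))) => [|_ ->|g gs].
  - exact: (submod_preim (scale_hom x : linhom _ _)).
  - by rewrite scale0r; apply: submod0.
  - exact: (gW (scaling (g : k)) (map_f _ gs)).
have [Wx|/maxW [c [w [Ww [Mv vN0]]]]] := pselect (W x).
  by exists x, 0; rewrite addr0; split=> //; apply: submod0.
apply: (maximal_ideal_cancel (c := c) max_m _ (submod_add SW submod_M)).
- move=> mc; apply: (WM (w + c *: x)) => //.
  by apply: submodD => //; apply: mW.
- move=> d md; exists (d *: x), 0; rewrite addr0; split=> //; first exact: mW.
  exact: submod0.
by exists (- w), (w + c *: x); rewrite addKr; split=> //; apply: submodN.
Qed.

Lemma noeth_essential : noeth_mod (fun x : restr I => x = 0) (fun=> True).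
Proof.
have [_ -> []//|W [SW _ WM maxW]] :=
  exists_max_disjoint (X := fun x => M x /\ x <> 0) (@submod_eq0 k (restr I)).
apply: (noeth_mod_exts
    (fs := [seq (homothety (e i) : linhom (restr I) (restr I)) | i : 'I_n]) SW _ (noeth_essential_mod SW WM maxW)) => //.
move=> T ST TW; exists [::] => // S SS S0 _ x /TW[_ eW]; apply: S0.
(* The joint kernel of the homotheties by the [e i] modulo [W] is the largest [L]-submodule inside
   [W]. It meets [iota L] trivially, so it vanishes by essentiality. *)
pose Z : {pred I} := fun y => `[< forall l : L, W (l *: y) >].
apply: (iota_ess (S := Z)).
- split=> [|c y z /asboolP Wy /asboolP Wz]; apply/asboolP => l.
    by rewrite scaler0; exact: (submod0 SW).
  by rewrite scalerDr scalerA; exact: (submodD SW (Wy _) (Wz _)).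
- move=> y /asboolP /(_ 1); rewrite scale1r => Wy; apply: contrapT => yN0.
  by apply: (WM _ Wy); split=> //; exists y.
apply/asboolP => l; have [c ->] := e_gen l; rewrite scaler_suml.
apply: (submod_sum (S := W)) => // i; rewrite -scalerA.
apply: (@submodZ k (restr I) W (c i) (e i *: x) SW); apply: (eW (homothety (e i))).
by apply/mapP; exists i; rewrite ?mem_enum.
Qed.

(** Generators over [k] also generate over [L]. The kernel of the resulting map from a free module
    is finitely generated for the same reason, that free module being noetherian over [k]. *)
Lemma fp_noeth_restr (V : lmodType L) :
  noeth_mod (fun x : restr V => x = 0) (fun=> True) ->
  finitely_presented_module V.
Proof.
move=> nV; have [|//|s _ sP] := nV (fun=> True); first by split.
pose p : linhom 'rV[L]_(size s) V := lincomb (fun j : 'I_(size s) => s`_j : V).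
have nF : noeth_mod (fun x : restr 'rV[L]_(size s) => x = 0) (fun=> True).
  apply: (@noeth_restr _ (size s) (fun j => delta_mx 0 j)) => x; exists x.
  by rewrite [RHS]row_sum_delta.
have Sker : submod (fun d : restr 'rV[L]_(size s) => p d = 0).
  exact: (submod_restr (submod_preim p (@submod_eq0 L V))).
have [//|r rP rK] := nF _ Sker.
exists (size r), (size s), (lincomb (fun j : 'I_(size r) => r`_j : 'rV[L]_(size s))), p.
have gen (U : lmodType L) (t : seq (restr U)) x : x \in t ->
    exists u, lincomb (fun j : 'I_(size t) => t`_j : U) u = x.
  move=> xt; have it : (index x t < size t)%N by rewrite index_mem.
  by exists (delta_mx 0 (Ordinal it)); rewrite lincomb_delta /= nth_index.
have img (U : lmodType L) (t : seq (restr U)) :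
    submod (fun x : restr U => exists u, lincomb (fun j : 'I_(size t) => t`_j : U) u = x).
  apply: submod_restr; split=> [|c _ _ [u <-] [u' <-]]; first by exists 0; rewrite raddf0.
  by exists (c *: u + u'); rewrite linearP.
split=> [d|x]; last first.
  apply: (sP _ (img V s)) => // [_ ->|y]; first by exists 0; rewrite raddf0.
  exact: gen.
split=> [pd|[u <-]].
  apply: (rK _ (img _ r)) => // [_ ->|y]; first by exists 0; rewrite raddf0.
  exact: gen.
rewrite [LHS](linhom_lincomb p) /lincomb big1 // => j _.
have -> : p r`_j = 0 by apply/rP/mem_nth.
by rewrite scaler0.
Qed.

End Essential.
End RestrictionOfScalars.

Lemma fp_essential (L : pzRingType) (I : lmodType L) (iota : linhom L^o I) :
  artin_algebra L -> essential iota -> finitely_presented_module I.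
Proof.
move=> [k [phi [artin_k phiC [n [e e_gen]]]]] iota_ess.
exact: (fp_noeth_restr e_gen artin_k (noeth_essential phiC e_gen artin_k iota_ess)).
Qed.

(** * Kernels of maps of tensor products *)

Local Notation "{ 'quot' I }" := (@Quotient.quot _ I) : type_scope.

Lemma zmod_quotient (V : zmodType) (N : {pred V}) : zmod_closed N ->
  exists (W : zmodType) (q : {additive V -> W}),
    (forall y, exists x, q x = y) /\ forall x, q x = 0 <-> x \in N.
Proof.
move=> NZ.
pose S : zmodClosed V := HB.pack N (GRing.isZmodClosed.Build V N NZ).
pose q (x : V) : {quot S} := \pi_{quot S} x.
have qB : zmod_morphism q by exact: pi_is_zmod_morphism.
pose q' : {additive V -> {quot S}} := HB.pack q (GRing.isZmodMorphism.Build _ _ q qB).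
exists {quot S}, q'; split=> [y|x].
  by exists (repr y); apply: reprK.
rewrite -[x in x \in N]subr0 (Quotient.idealrBE S); split=> [qx0|/eqP qx0].
  by apply/eqP; rewrite pi_zeror; exact: qx0.
by rewrite /= /q qx0 pi_zeror.
Qed.

Lemma lmod_quotient (K : pzRingType) (V : lmodType K) (N : V -> Prop) :
  submod N ->
  exists (W : lmodType K) (q : linhom V W),
    (forall y, exists x, q x = y) /\ forall x, q x = 0 <-> N x.
Proof.
move=> SN; have NZ : zmod_closed [pred x | `[< N x >]].
  split=> [|x y /asboolP Nx /asboolP Ny]; apply/asboolP; first exact: submod0.
  exact: submodB.
have [[W cW] [q [q_surj qP]]] := zmod_quotient NZ.
have [r rK] := choice q_surj.
have qN x : q x = 0 <-> N x by rewrite qP; split=> /asboolP.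
have q_eq x y : N (x - y) -> q x = q y.
  by move=> /qN; rewrite raddfB => /subr0_eq.
have Nr x : N (r (q x) - x) by apply/qN; rewrite raddfB rK subrr.
(* Scalars act on chosen representatives; the choice is immaterial because [N] is stable under
   scaling. *)
pose sc (c : K) (y : GRing.Zmodule.Pack cW) := q (c *: r y).
have scq c x : sc c (q x) = q (c *: x).
  by apply: q_eq; rewrite -scalerBr; apply: submodZ.
have scA a b y : sc a (sc b y) = sc (a * b) y by rewrite {2}/sc scq scalerA.
have sc1 : left_id 1 sc by move=> y; rewrite /sc scale1r.
have scDr : right_distributive sc +%R.
  by move=> c x y; rewrite -[x]rK -[y]rK -raddfD !scq scalerDr raddfD.
have scDl y : {morph sc^~ y : a b / a + b}.
  by move=> a b; rewrite /sc scalerDl raddfD.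
pose W' : lmodType K := HB.pack W (GRing.Zmodule.Pack cW)
  (GRing.Zmodule_isLmodule.Build K (GRing.Zmodule.Pack cW) scA sc1 scDr scDl).
have q_lin : linear (q : V -> W').
  by move=> c x y; rewrite raddfD; congr (_ + _); rewrite -scq.
pose q' : {linear V -> W'} :=
  HB.pack (q : V -> W') (GRing.isLinear.Build K V W' _ _ q_lin).
by exists W', q'.
Qed.

Lemma linhom_factor (K : pzRingType) (U V W : lmodType K) (p : linhom U V)
    (g : linhom U W) :
  (forall y, exists x, p x = y) -> (forall x, p x = 0 -> g x = 0) ->
  exists h : linhom V W, forall x, h (p x) = g x.
Proof.
move=> p_surj pg; have [r rK] := choice p_surj.
have hp x : g (r (p x)) = g x.
  apply/eqP; rewrite -subr_eq0 -raddfB; apply/eqP/pg.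
  by rewrite linearB rK subrr.
have h_lin : linear (fun y => g (r y)).
  by move=> c x y; rewrite -linearP -[RHS]hp linearP !rK.
pose h : {linear V -> W} :=
  HB.pack (fun y => g (r y)) (GRing.isLinear.Build K V W _ _ h_lin).
by exists h.
Qed.

Section TensorKernel.
Context (L R : pzRingType) (o : L -> R).

Lemma tensor_lift (A : lmodType R) (M : lmodType L) (W : zmodType)
    (f : A -> M -> W) :
  (forall a a' m, f (a + a') m = f a m + f a' m) ->
  (forall a m m', f a (m + m') = f a m + f a m') ->
  (forall a l m, f (o l *: a) m = f a (l *: m)) ->
  exists h : {additive tensor o A M -> W}, forall a m, h (pure_tensor o a m) = f a m.
Proof.
move=> fDl fDr fM.
pose F (x : free_group A M) : W := fglift (fun p : A * M => f p.1 p.2 : zmodule _) x.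
have FB : zmod_morphism F.
  by move=> x y; exact: (@lift_is_additive int (A * M)%type (zmodule _) _ x y).
pose F' : {additive free_group A M -> W} :=
  HB.pack F (GRing.isZmodMorphism.Build _ _ F FB).
have Fgen a m : F' (free_gen a m) = f a m by rewrite /F' /= /F /= liftU scale1r.
have F0 x : x \in @tensor_null L R o A M -> F x = 0.
  move=> /asboolP xN; apply/eqP.
  apply: (xN [pred y | F y == 0]) => [|y].
    split=> [|u v /eqP u0 /eqP v0]; apply/eqP; first exact: (raddf0 F').
    by rewrite FB u0 v0 subrr.
  case=> [a a' m|a m m'|a l m]; apply/eqP.
  - by rewrite -[LHS]/(F' _) !raddfB !Fgen fDl addrAC addrK subrr.
  - by rewrite -[LHS]/(F' _) !raddfB !Fgen fDr addrAC addrK subrr.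
  - by rewrite -[LHS]/(F' _) !raddfB !Fgen fM subrr.
pose h (x : tensor o A M) : W := F (repr x).
have hpi x : h (\pi_{quot (@tensor_null L R o A M)} x) = F x.
  apply/eqP; rewrite -subr_eq0 -FB; apply/eqP/F0.
  by rewrite Quotient.idealrBE reprK.
have hB : zmod_morphism h.
  by move=> x y; rewrite -[x]reprK -[y]reprK -pi_is_zmod_morphism !hpi FB.
pose h' : {additive tensor o A M -> W} :=
  HB.pack h (GRing.isZmodMorphism.Build _ _ h hB).
exists h' => a m.
by rewrite -Fgen /= -hpi.
Qed.

(** Right exactness of the tensor product: the kernel of [f ⊗ g] is generated by the tensors [a ⊗ m]
    with [f a = 0] or [g m = 0]. The quotient map by [N] depends on [a ⊗ m] only through [f a] and
    [g m], so it factors through [f ⊗ g]. *)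
Lemma tensor_ker (A A' : lmodType R) (M M' : lmodType L) (f : linhom A A')
    (g : linhom M M') (N : {pred tensor o A M}) :
  (forall y, exists x, f x = y) -> (forall y, exists x, g x = y) ->
  zmod_closed N ->
  (forall a m, f a = 0 -> pure_tensor o a m \in N) ->
  (forall a m, g m = 0 -> pure_tensor o a m \in N) ->
  forall z, tensor_map o f g z = 0 -> z \in N.
Proof.
move=> f_surj g_surj NZ fN gN.
have [W [q [_ qN]]] := zmod_quotient NZ.
have [r rK] := choice f_surj; have [s sK] := choice g_surj.
have pB a a' m : pure_tensor o (a - a') m = pure_tensor o a m - pure_tensor o a' m.
  by apply: (addIr (pure_tensor o a' m)); rewrite -pure_tensorDl !subrK.
have pB' a m m' : pure_tensor o a (m - m') = pure_tensor o a m - pure_tensor o a m'.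
  by apply: (addIr (pure_tensor o a m')); rewrite -pure_tensorDr !subrK.
have q_eq a a' m m' : f a = f a' -> g m = g m' ->
    q (pure_tensor o a m) = q (pure_tensor o a' m').
  move=> faa' gmm'; transitivity (q (pure_tensor o a' m)); apply: subr0_eq;
    rewrite -raddfB; apply/qN; rewrite -?pB -?pB'.
    by apply: fN; rewrite linearB faa' subrr.
  by apply: gN; rewrite linearB gmm' subrr.
have [|||h hP] := @tensor_lift A' M' W (fun a m => q (pure_tensor o (r a) (s m))).
- move=> a a' m; rewrite -raddfD -pure_tensorDl; apply: q_eq => //.
  by rewrite linearD !rK.
- move=> a m m'; rewrite -raddfD -pure_tensorDr; apply: q_eq => //.
  by rewrite linearD !sK.
- move=> a l m; rewrite -[RHS](q_eq (r a) _ (l *: s m)) // -?pure_tensorM.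
    by apply: q_eq => //; rewrite linearZ_LR /= !rK.
  by rewrite linearZ_LR /= !sK.
move=> z zN; apply/qN.
have -> : q z = h (tensor_map o f g z).
  move: z {zN}.
  apply: (@tensor_additive_ext _ _ _ _ _ _ q (h \o tensor_map o f g)) => a m /=.
  by rewrite tensor_map_pure hP; apply: q_eq; rewrite ?rK ?sK.
by rewrite zN raddf0.
Qed.

End TensorKernel.

(** * Universal solutions of tensor equations *)

Lemma coker_matrix (K : pzRingType) (p q : nat) (B : 'M[K]_(p, q)) :
  exists (A : lmodType K) (f : linhom 'rV[K]_q A), [/\ finitely_presented_module A,
    (forall y, exists x, f x = y) & forall v, f v = 0 <-> exists u, v = u *m B].
Proof.
pose g : linhom 'rV[K]_p 'rV[K]_q := mulmxr B : {linear _ -> _}.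
have [|A [f [f_surj fP]]] := @lmod_quotient K 'rV[K]_q (fun v => exists u, v = g u).
  split=> [|c _ _ [u ->] [u' ->]]; first by exists 0; rewrite linear0.
  by exists (c *: u + u'); rewrite linearP.
exists A, f; split=> //; exists p, q, g, f; split=> // v.
by rewrite fP; split=> -[u uE]; exists u.
Qed.

Section UniversalElement.
Context (L R : pzRingType) (o : L -> R) (o' : R -> L).
Hypotheses (oD : {morph o : x y / x + y}) (oM : forall x y, o (x * y) = o y * o x).
Hypotheses (oK : cancel o o') (o'K : cancel o' o).

Let o'D : {morph o' : x y / x + y}.
Proof. by move=> x y; apply: (can_inj oK); rewrite oD !o'K. Qed.
Let o'M x y : o' (x * y) = o' y * o' x.
Proof. by apply: (can_inj oK); rewrite oM !o'K. Qed.
Let o'1 : o' 1 = 1.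
Proof. by rewrite -[LHS]mul1r -[X in X * _]oK -o'M mul1r oK. Qed.
Let o0 : o 0 = 0.
Proof. by apply: (addrI (o 0)); rewrite -oD !addr0. Qed.
Let o'0 : o' 0 = 0.
Proof. by apply: (can_inj oK); rewrite o'K o0. Qed.
Let o'N x : o' (- x) = - o' x.
Proof. by apply: (addrI (o' x)); rewrite -o'D !subrr o'0. Qed.
Let o_sum (J : Type) (s : seq J) (F : J -> L) :
  o (\sum_(j <- s) F j) = \sum_(j <- s) o (F j).
Proof. exact: (big_morph o oD o0). Qed.
Let o'_sum (J : Type) (s : seq J) (F : J -> R) :
  o' (\sum_(j <- s) F j) = \sum_(j <- s) o' (F j).
Proof. exact: (big_morph o' o'D o'0). Qed.

Lemma pure_tensor0l (A : lmodType R) (M : lmodType L) m :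
  pure_tensor o (0 : A) (m : M) = 0.
Proof. by apply: (addrI (pure_tensor o 0 m)); rewrite -pure_tensorDl !addr0. Qed.

Lemma pure_tensor0r (A : lmodType R) (M : lmodType L) a :
  pure_tensor o (a : A) (0 : M) = 0.
Proof. by apply: (addrI (pure_tensor o a 0)); rewrite -pure_tensorDr !addr0. Qed.

Lemma pure_tensor_suml (A : lmodType R) (M : lmodType L) (J : Type) (s : seq J)
    (a : J -> A) (m : M) :
  pure_tensor o (\sum_(j <- s) a j) m = \sum_(j <- s) pure_tensor o (a j) m.
Proof.
apply: (big_morph (fun a => pure_tensor o a m)) => [x y|].
  exact: pure_tensorDl.
exact: pure_tensor0l.
Qed.

Lemma pure_tensor_sumr (A : lmodType R) (M : lmodType L) (J : Type) (s : seq J)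
    (a : A) (m : J -> M) :
  pure_tensor o a (\sum_(j <- s) m j) = \sum_(j <- s) pure_tensor o a (m j).
Proof.
apply: (big_morph (fun m => pure_tensor o a m)) => [x y|].
  exact: pure_tensorDr.
exact: pure_tensor0r.
Qed.

(* For [I] with generators [y_j], relations [sum_j r_ij y_j = 0] and
   [w = sum_j c_j y_j], an element [b] satisfies [b (x) w = 0] iff
   [b c_j = sum_i b_i r_ij] for some [b_i]; [(A, a)] is the universal solution. *)
Lemma universal_annihilator (I : lmodType L) (w : I) :
  finitely_presented_module I ->
  exists (A : lmodType R) (a : A), [/\ finitely_presented_module A,
    pure_tensor o a w = 0,
    forall (B : lmodType R) (b : B), pure_tensor o b w = 0 ->
      exists h : linhom A B, h a = b,
    forall (X : lmodType L) (x : X), pure_tensor o a x = 0 ->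
      exists u : linhom I X, u w = x &
    exists (A' : lmodType R) (p : linhom A A'), [/\ finitely_presented_module A',
      (forall y, exists x, p x = y) & forall x, p x = 0 <-> exists c, x = c *: a]].
Proof.
move=> [m [n [f [p [fpE p_surj]]]]].
pose r := lin1_mx f.
have {}fpE d : p d = 0 <-> exists u, u *m r = d.
  by split=> [/fpE[u <-]|[u <-]]; [|apply/fpE]; exists u; rewrite mul_rV_lin1.
have [c pc] := p_surj w.
(* Column 0 stands for the unknown [b] and column [1 + i] for the auxiliary unknown [b_i]; row [j]
   is the equation [b c_j = sum_i b_i r_ij]. *)
pose B : 'M[R]_(n, 1 + m) :=
  row_mx (\col_j o (c 0 j)) (\matrix_(j, i) - o (r i j)).
have [A [q [fpA q_surj qP]]] := coker_matrix B.
pose e0 : 'rV[R]_(1 + m) := delta_mx 0 (lshift m 0).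
pose e i : 'rV[R]_(1 + m) := delta_mx 0 (rshift 1 i).
have lincombB (V : lmodType R) (b : 'I_(1 + m) -> V) j :
    lincomb b (row j B) = o (c 0 j) *: b (lshift m 0) -
      \sum_i o (r i j) *: b (rshift 1 i).
  rewrite /lincomb big_split_ord big_ord1 -sumrN; congr (_ + _).
    by rewrite mxE row_mxEl mxE.
  by apply: eq_bigr => i _; rewrite mxE row_mxEr mxE scaleNr.
have q_lincomb v : q v = lincomb (fun i => q (delta_mx 0 i)) v.
  by rewrite {1}[v]row_sum_delta linear_sum; apply: eq_bigr => i _; rewrite linearZ_LR.
have q_rel j : o (c 0 j) *: q e0 = \sum_i o (r i j) *: q (e i).
  apply: subr0_eq; rewrite -(lincombB A (fun i => q (delta_mx 0 i))) -q_lincomb.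
  by apply/qP; exists (delta_mx 0 j); rewrite rowE.
exists A, (q e0); split=> //.
(* With [a_i = q (e i)], one has [a ⊗ w = sum_j a c_j ⊗ y_j = sum_i a_i ⊗ (sum_j r_ij y_j) = 0]. *)
- rewrite -pc {1}[c]row_sum_delta linear_sum pure_tensor_sumr.
  pose F i j := pure_tensor o (q (e i)) (r i j *: p (delta_mx 0 j)).
  rewrite (eq_bigr (fun j => \sum_i F i j)) => [|j _]; last first.
    rewrite linearZ_LR -pure_tensorM q_rel pure_tensor_suml.
    by apply: eq_bigr => i _; rewrite pure_tensorM.
  rewrite exchange_big big1 // => i _; rewrite -pure_tensor_sumr.
  have -> : \sum_j r i j *: p (delta_mx 0 j) = p (row i r).
    rewrite [row i r]row_sum_delta linear_sum; apply: eq_bigr => j _.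
    by rewrite [row i r 0 j]mxE [RHS]linearZ_LR.
  have -> : p (row i r) = 0 by apply/fpE; exists (delta_mx 0 i); rewrite rowE.
  exact: pure_tensor0r.
- move=> V b bw.
  (* The [co j] are the coordinates of [V ⊗ L^n = V^n]. Since [b ⊗ c] dies in [V ⊗ I], its
     coordinates [b c_j] are combinations of the relations [r]. *)
  have /choice[co coP] : forall j, exists h : {additive tensor o V 'rV[L]_n -> V},
      forall b d, h (pure_tensor o b d) = o (d 0 j) *: b.
    move=> j; apply: tensor_lift => [a a' d|a d d'|a l d]; first exact: scalerDr.
      by rewrite mxE oD scalerDl.
    by rewrite mxE oM scalerA.
  pose N : {pred tensor o V 'rV[L]_n} := fun z =>
    `[< exists b, forall j, co j z = \sum_i o (r i j) *: b i >].
  have NZ : zmod_closed N.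
    split=> [|x y /asboolP[bx xE] /asboolP[by_ yE]]; apply/asboolP.
      by exists (fun=> 0) => j; rewrite raddf0 big1 // => i _; rewrite scaler0.
    exists (fun i => bx i - by_ i) => j; rewrite raddfB xE yE -sumrB.
    by apply: eq_bigr => i _; rewrite scalerBr.
  have /asboolP[b' b'E] : pure_tensor o b c \in N.
    apply: (@tensor_ker _ _ o _ _ _ _ (linhom_id V) p) => // [y|x d x0|x d pd|].
    - by exists y.
    - apply/asboolP; exists (fun=> 0) => j.
      have -> : x = 0 by exact: x0.
      by rewrite coP scaler0 big1 // => i _; rewrite scaler0.
    - apply/asboolP; have [u <-] := (fpE d).1 pd.
      exists (fun i => o (u 0 i) *: x) => j; rewrite coP mxE o_sum scaler_suml.
      by apply: eq_bigr => i _; rewrite oM scalerA.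
    by rewrite tensor_map_pure pc.
  pose bb (i : 'I_(1 + m)) := match split i with inl _ => b | inr i => b' i end.
  have bb0 : bb (lshift m 0) = b by rewrite /bb (unsplitK (inl _)).
  have bbS i : bb (rshift 1 i) = b' i by rewrite /bb (unsplitK (inr _)).
  have [v /qP[u ->]|h hq] := linhom_factor (g := lincomb bb : linhom _ _) q_surj.
    rewrite [u]row_sum_delta mulmx_suml linear_sum big1 // => j _.
    rewrite -scalemxAl -rowE linearZ_LR /= lincombB bb0.
    rewrite -[X in X - _](coP j b c) b'E.
    under [X in _ - X]eq_bigr do rewrite bbS.
    by rewrite subrr scaler0.
  by exists h; rewrite hq /= lincomb_delta.
- move=> X x ax.
  (* Symmetrically, [e0 ⊗ x] dies in [A ⊗ X], so it is a sum of tensors of rows of [B] with elements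
     [y_j] of [X]. Coordinate 0 reads [x = sum_j c_j y_j] and coordinate [1 + i] reads
     [0 = sum_j r_ij y_j]: the [y_j] define a map from [I] sending [w] to [x]. *)
  have /choice[co coP] : forall i, exists h : {additive tensor o 'rV[R]_(1 + m) X -> X},
      forall v x, h (pure_tensor o v x) = o' (v 0 i) *: x.
    move=> i; apply: tensor_lift => [v v' y|v y y'|v l y]; last 1 first.
    - by rewrite mxE o'M oK scalerA.
    - by rewrite mxE o'D scalerDl.
    - exact: scalerDr.
  pose N : {pred tensor o 'rV[R]_(1 + m) X} := fun z =>
    `[< exists y, forall i, co i z = \sum_j o' (B j i) *: y j >].
  have NZ : zmod_closed N.
    split=> [|z t /asboolP[bz zE] /asboolP[bt tE]]; apply/asboolP.
      by exists (fun=> 0) => i; rewrite raddf0 big1 // => j _; rewrite scaler0.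
    exists (fun j => bz j - bt j) => i; rewrite raddfB zE tE -sumrB.
    by apply: eq_bigr => j _; rewrite scalerBr.
  have /asboolP[y yE] : pure_tensor o e0 x \in N.
    apply: (@tensor_ker _ _ o _ _ _ _ q (linhom_id X)) => // [y|v y /qP[u ->]|v y y0|].
    - by exists y.
    - apply/asboolP; exists (fun j => o' (u 0 j) *: y) => i.
      rewrite coP mxE o'_sum scaler_suml.
      by apply: eq_bigr => j _; rewrite o'M scalerA.
    - apply/asboolP; exists (fun=> 0) => i.
      have -> : y = 0 by exact: y0.
      by rewrite coP scaler0 big1 // => j _; rewrite scaler0.
    by rewrite tensor_map_pure.
  have xE : lincomb y c = x.
    have := yE (lshift m 0); rewrite coP mxE !eqxx o'1 scale1r => ->.
    by apply: eq_bigr => j _; rewrite row_mxEl mxE oK.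
  have rel i : lincomb y (row i r) = 0.
    have := yE (rshift 1 i); rewrite coP mxE eqxx eq_rlshift o'0 scale0r.
    move=> /(congr1 -%R); rewrite oppr0 -sumrN => ->.
    by apply: eq_bigr => j _; rewrite row_mxEr !mxE o'N oK scaleNr opprK.
  have [d /fpE[u <-]|h hp] := linhom_factor (g := lincomb y : linhom _ _) p_surj.
    rewrite [u]row_sum_delta mulmx_suml linear_sum big1 // => i _.
    by rewrite -scalemxAl -rowE linearZ_LR /= rel scaler0.
  by exists h; rewrite -pc hp.
(* Adding the row [e0] to the relations presents [A / a R]. *)
have [A' [q' [fpA' q'_surj q'P]]] := coker_matrix (col_mx B e0).
have [v /qP[u ->]|h hq] := linhom_factor (g := q') q_surj.
  by apply/q'P; exists (row_mx u 0); rewrite mul_row_col mul0mx addr0.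
exists A', h; split=> // [y|x].
  by have [v <-] := q'_surj y; exists (q v).
have [v <-] := q_surj x; rewrite hq q'P; split=> [[u ->]|[d vE]].
  rewrite -[u]hsubmxK mul_row_col linearD.
  have -> : q (lsubmx u *m B) = 0 by apply/qP; exists (lsubmx u).
  exists (rsubmx u 0 0); rewrite add0r -linearZ; congr (q _).
  by rewrite {1}[rsubmx u]mx11_scalar mul_scalar_mx.
have /qP[u uE] : q (v - d *: e0) = 0 by rewrite linearB linearZ_LR vE subrr.
by exists (row_mx u d%:M); rewrite mul_row_col mul_scalar_mx -uE subrK.
Qed.

End UniversalElement.

(** * Torsion and cotorsion functors *)

Local Notation hom := Defs.hom.

Section AbelianFunctors.
Context (C : category).
Implicit Types F G H : functor C Ab.

(** This and the next two definitions retype values and arrows in [Ab] as groups and additive maps,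
    so that the algebraic lemmas apply to them. *)
Definition val_at F (a : C) : zmodType := F a.
Definition nat_fun F G (t : nattrans F G) (a : C) :
  {additive val_at F a -> val_at G a} := t a.
Definition fmap_fun F (a b : C) (f : hom a b) :
  {additive val_at F a -> val_at F b} := fmap F f.

Lemma nat_funE F G (t : nattrans F G) (a b : C) (f : hom a b) x :
  nat_fun t b (fmap_fun F f x) = fmap_fun G f (nat_fun t a x).
Proof.
exact: (congr1 (fun h : {additive val_at F a -> val_at G b} => h x)
  (naturality t f)).
Qed.

Lemma nat_fun_ext F G (s t : nattrans F G) :
  (forall a x, nat_fun s a x = nat_fun t a x) -> s = t.
Proof. by move=> st; apply: nattrans_ext => a; apply: additive_ext => x; apply: st. Qed.

Lemma nattrans_of_fun F G (h : forall a, val_at F a -> val_at G a) :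
  (forall a, zmod_morphism (h a)) ->
  (forall (a b : C) (f : hom a b) x, h b (fmap_fun F f x) = fmap_fun G f (h a x)) ->
  exists t : nattrans F G, forall a x, nat_fun t a x = h a x.
Proof.
move=> hB hN.
pose t a : {additive val_at F a -> val_at G a} :=
  HB.pack (h a) (GRing.isZmodMorphism.Build (val_at F a) (val_at G a) (h a) (hB a)).
have tN (a b : C) (f : hom a b) :
    cmp (t b : @hom Ab _ _) (fmap F f) = cmp (fmap G f) (t a : @hom Ab _ _).
  by apply: additive_ext => x; apply: hN.
by exists (@NatTrans C Ab F G t tN).
Qed.

Lemma nattrans_factor F G H (p : nattrans F G) (h : nattrans F H) :
  (forall a y, exists x, nat_fun p a x = y) ->
  (forall a x, nat_fun p a x = 0 -> nat_fun h a x = 0) ->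
  exists h' : nattrans G H, forall a x, nat_fun h' a (nat_fun p a x) = nat_fun h a x.
Proof.
move=> p_surj ph.
pose r a := projT1 (choice (p_surj a)).
have rK a y : nat_fun p a (r a y) = y by exact: projT2 (choice (p_surj a)) y.
have hp a x y : nat_fun p a x = nat_fun p a y -> nat_fun h a x = nat_fun h a y.
  by move=> xy; apply: subr0_eq; rewrite -raddfB; apply: ph; rewrite raddfB xy subrr.
have [|a b f x|h' h'E] := @nattrans_of_fun G H (fun a y => nat_fun h a (r a y)).
- by move=> a x y; rewrite -raddfB; apply: hp; rewrite raddfB !rK.
- by rewrite -nat_funE; apply: hp; rewrite nat_funE !rK.
by exists h' => a x; rewrite h'E; apply: hp; rewrite rK.
Qed.

Lemma nattrans_lift F G H (i : nattrans G H) (t : nattrans F H) :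
  (forall a y, nat_fun i a y = 0 -> y = 0) ->
  (forall a x, exists y, nat_fun i a y = nat_fun t a x) ->
  exists t' : nattrans F G, forall a x, nat_fun i a (nat_fun t' a x) = nat_fun t a x.
Proof.
move=> i0 it.
pose r a := projT1 (choice (it a)).
have rK a x : nat_fun i a (r a x) = nat_fun t a x by exact: projT2 (choice (it a)) x.
have i_inj a : injective (nat_fun i a).
  by move=> x y xy; apply/subr0_eq/i0; rewrite raddfB xy subrr.
have [|a b f x|t' t'E] := @nattrans_of_fun F G r.
- by move=> a x y; apply: i_inj; rewrite raddfB !rK raddfB.
- by apply: i_inj; rewrite rK nat_funE nat_funE rK.
by exists t' => a x; rewrite t'E rK.
Qed.

End AbelianFunctors.

Lemma nat_fun_cmpK (C : category) (F G : functor C Ab) (s : nattrans F G)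
    (t : nattrans G F) a :
  @cmp (functor_category C Ab) F G F t s = @idm (functor_category C Ab) F ->
  cancel (nat_fun s a) (nat_fun t a).
Proof. by move=> ts x; exact: (congr1 (fun u => nat_fun u a x) ts). Qed.

Lemma iso_components (C D : category) (F G : functor C D) :
  @iso (functor_category C D) F G ->
  exists (s : forall a, hom (F a) (G a)) (t : forall a, hom (G a) (F a)),
    [/\ forall a, cmp (t a) (s a) = idm (F a), forall a, cmp (s a) (t a) = idm (G a) &
      forall (a b : C) (f : hom a b), cmp (s b) (fmap F f) = cmp (fmap G f) (s a)].
Proof.
move=> [s [t [ts st]]]; exists s, t; split=> [a|a|a b f]; last exact: naturality.
- exact: (congr1 (fun u : nattrans F F => u a) ts).
- exact: (congr1 (fun u : nattrans G G => u a) st).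
Qed.

(** * Right adjoints of contravariant functors as representing objects *)

Section Contravariant.
Context (C D : category) (DA : functor (op C) D).

(* Typed on [C] instead of [op C]: identifying the objects of the two unfolds
   [C], which is slow when [C] is a category of functors. *)
Definition contra_ob (F : C) : D := DA F.

Definition contra_map (F G : C) (h : hom F G) : hom (contra_ob G) (contra_ob F) :=
  @fmap (op C) D DA G F h.

Lemma contra_map1 F : contra_map (idm F) = idm (contra_ob F).
Proof. exact: (@fmap1 (op C) D DA F). Qed.

Lemma contra_mapM (F G H : C) (g : hom G H) (f : hom F G) :
  contra_map (cmp g f) = cmp (contra_map f) (contra_map g).
Proof. exact: (@fmapM (op C) D DA H G F f g). Qed.

(** A Yoneda argument: the adjunction makes [DR s] represent [Hom(s, DA _)], and the universal map
    [eps] makes [q] represent it too. *)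
Lemma right_adjoint_contra_iso (DR : functor (op D) C) (s : D) (q : C)
    (eps : hom s (contra_ob q)) :
  right_adjoint_contra DA DR ->
  (forall (F : C) (t : hom s (contra_ob F)),
    exists h : hom F q, cmp (contra_map h) eps = t) ->
  (forall (F : C) (h h' : hom F q),
    cmp (contra_map h) eps = cmp (contra_map h') eps -> h = h') ->
  iso (DR s) q.
Proof.
move=> [phi [phi_bij phiN]] eps_surj eps_inj.
have phi_cmp (F F' : C) (u : hom F' F) (h : hom F (DR s)) :
    phi F' s (cmp h u) = cmp (contra_map u) (phi F s h).
  have := phiN F F' s s u (idm s) h.
  by rewrite (@fmap1 (op D) C DR s) cmp1m cmpm1.
have [beta betaE] := eps_surj (DR s) (phi (DR s) s (idm (DR s))).
have [psi _ phiK] := phi_bij q s.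
exists beta, (psi eps); split.
  have [psi' phi'K _] := phi_bij (DR s) s; apply: (can_inj phi'K).
  by rewrite phi_cmp phiK.
apply: eps_inj; rewrite contra_map1 cmp1m contra_mapM -cmpA betaE.
by rewrite -phi_cmp cmp1m phiK.
Qed.

End Contravariant.

(** * Torsion and cotorsion under the duality [DA] *)

Section Duality.
Context (L R : pzRingType) (o : L -> R) (o' : R -> L).
Hypotheses (oD : {morph o : x y / x + y}) (oM : forall x y, o (x * y) = o y * o x).
Hypotheses (oK : cancel o o') (o'K : cancel o' o).
Context (I : lmodType L) (iota : linhom L^o I).
Hypothesis fpI : finitely_presented_module I.

Local Notation w := (iota (1 : L^o)).

Lemma torsion_subE (A : lmodType R) (a : A) :
  (a \in @torsion_sub _ _ o _ iota A) = (pure_tensor o a w == 0).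
Proof. by rewrite unfold_in /torsion_sub tensor_map_pure. Qed.

Lemma torsion_nattrans_pure (X : lmodType L)
    (t : nattrans (torsion_functor o iota) (tensor_functor o X)) :
  exists x : X, forall (B : fpMod R) (b : torsion o iota (sval B)),
    nat_fun t B b = pure_tensor o (torsion_val b) x.
Proof.
have [A [a [fpA aw a_univ _ [A' [p [fpA' p_surj pP]]]]]] :=
  universal_annihilator oD oM oK o'K w fpI.
pose A0 : fpMod R := exist _ A fpA; pose A1 : fpMod R := exist _ A' fpA'.
have aS : a \in @torsion_sub _ _ o _ iota A by rewrite torsion_subE aw.
pose a0 : torsion o iota A := Torsion aS.
(* The tensors [a ⊗ x] form a subgroup that contains the kernel of [A ⊗ X -> (A / a R) ⊗ X], since
   [a r ⊗ x = a ⊗ r x]. *)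
pose N : {pred tensor o A X} := fun z => `[< exists x, z = pure_tensor o a x >].
have NZ : zmod_closed N.
  split=> [|_ _ /asboolP[x ->] /asboolP[y ->]]; apply/asboolP.
    by exists 0; rewrite pure_tensor0r.
  by exists (x - y); apply: (addIr (pure_tensor o a y)); rewrite -pure_tensorDr !subrK.
have pa : p a = 0 by apply/pP; exists 1; rewrite scale1r.
have /asboolP[x xE] : (nat_fun t A0 a0 : tensor o A X) \in N.
  apply: (@tensor_ker _ _ o _ _ _ _ p (linhom_id X)) => // [y|_ x /pP[c ->]|v x x0|].
  - by exists y.
  - by apply/asboolP; exists (o' c *: x); rewrite -pure_tensorM o'K.
  - have -> : x = 0 by exact: x0.
    by apply/asboolP; exists 0; rewrite !pure_tensor0r.
  rewrite -[LHS](@nat_funE _ _ _ t A0 A1 p a0).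
  have -> : fmap_fun (torsion_functor o iota) (p : @hom (fpMod R) A0 A1) a0 = 0.
    exact: val_inj.
  exact: raddf0.
exists x => B b.
have [|h ha] := a_univ (sval B) (torsion_val b).
  by apply/eqP; rewrite -torsion_subE; apply: torsionP.
have -> : b = fmap_fun (torsion_functor o iota) (h : @hom (fpMod R) A0 B) a0.
  by apply: val_inj; rewrite /= ha.
by rewrite nat_funE xE [LHS]tensor_map_pure.
Qed.

Lemma torsion_pure_eq0 (X : lmodType L) (x : X) :
  (forall (B : fpMod R) (b : torsion o iota (sval B)),
    pure_tensor o (torsion_val b) x = 0) ->
  exists u : linhom I X, u w = x.
Proof.
have [A [a [fpA aw _ a_ext _]]] := universal_annihilator oD oM oK o'K w fpI.
have aS : a \in @torsion_sub _ _ o _ iota A by rewrite torsion_subE aw.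
by move=> /(_ (exist _ A fpA) (Torsion aS))/a_ext.
Qed.

Definition cotorsion_proj : nattrans (hom_functor L^o) (cotorsion_functor iota).
Proof.
refine (@NatTrans _ _ (hom_functor L^o) (cotorsion_functor iota)
  (fun C => (@cotorsion_class L I iota C : {additive _ -> _})) _).
by move=> C D f; apply: additive_ext => h; rewrite /= cotorsion_map_class.
Defined.

Lemma cotorsion_class_eq0 (C : lmodType L) (h : linhom L^o C) :
  cotorsion_class iota h = 0 <-> exists u : linhom I C, precomp iota u = h.
Proof.
pose q := @cotorsion_class L I iota C.
have -> : (cotorsion_class iota h = 0) = (q h = q 0) by rewrite /q raddf0.
rewrite (_ : (q h = q 0) = (h - 0 \in @factors L I iota C)); last first.
  by rewrite Quotient.idealrBE; apply/propext; split=> [/eqP|/eqP].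
by rewrite subr0; split=> /asboolP.
Qed.

Lemma cotorsion_proj_exact : functor_exact (hom_nattrans iota) cotorsion_proj.
Proof. by move=> C h; apply: cotorsion_class_eq0. Qed.

(** By Yoneda, [h] is determined by its value at the identity of [X], which is the class of some
    [g]. *)
Lemma cotorsion_nattrans_lift (X : lmodType L)
    (h : nattrans (hom_functor X) (cotorsion_functor iota)) :
  exists g : linhom L^o X, forall (U : Mod L) (k : linhom X U),
    nat_fun h U k = cotorsion_class iota (linhom_comp k g).
Proof.
have [g gE] := cotorsion_classP (nat_fun h X (linhom_id X) : cotorsion iota X).
exists g => U k; rewrite -cotorsion_map_class gE.
rewrite -[RHS](nat_funE h (k : @hom (Mod L) X U) (linhom_id X)).
by congr (nat_fun h U _); apply: linhom_ext.
Qed.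

Context (DA : functor (op (fpFun L)) (AddFun R)).
Hypothesis DA_is_DA : is_DA o DA.

Definition DA_fun (F : fpFun L) : functor (fpMod R) Ab := sval (contra_ob DA F).

Definition DA_map (F G : fpFun L) (h : @hom (fpFun L) F G) :
  nattrans (DA_fun G) (DA_fun F) := contra_map DA h.

Lemma DA_mapM (F G H : fpFun L) (g : @hom (fpFun L) G H) (f : @hom (fpFun L) F G)
    A x :
  nat_fun (DA_map (cmp g f)) A x = nat_fun (DA_map f) A (nat_fun (DA_map g) A x).
Proof. by rewrite /DA_map contra_mapM. Qed.

Lemma DA_map_exact (F G H : fpFun L) (a : @hom (fpFun L) F G)
    (b : @hom (fpFun L) G H) A y :
  functor_exact a b ->
  nat_fun (DA_map a) A y = 0 <-> exists x, nat_fun (DA_map b) A x = y.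
Proof. by move=> /(DA_is_DA.1 _ _ _ a b)/(_ A y). Qed.

(** The sequence [F -> F -> G] formed by the identity and a zero map is exact, so the image of
    [DA z] is the kernel of an identity. *)
Lemma DA_map0 (F G : fpFun L) (z : @hom (fpFun L) F G) A x :
  (forall U y, nat_fun z U y = 0) -> nat_fun (DA_map z) A x = 0.
Proof.
move=> z0.
have idz : functor_exact (@idm (fpFun L) F) z.
  by move=> U y; split=> _; [exists y | exact: z0].
have /(@DA_map_exact F F G (idm F) z A _ idz).2 :
    exists x', nat_fun (DA_map z) A x' = nat_fun (DA_map z) A x.
  by exists x.
by rewrite /DA_map contra_map1.
Qed.

(** An epimorphism followed by a zero map is exact, and [DA] reverses this into a zero map followed
    by [DA p]. *)
Lemma DA_map_mono (F G : fpFun L) (p : @hom (fpFun L) F G) A y :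
  (forall U y, exists x, nat_fun p U x = y) -> nat_fun (DA_map p) A y = 0 -> y = 0.
Proof.
move=> p_surj.
have [||z z0] := @nattrans_of_fun (Mod L) (sval G) (sval G) (fun _ _ => 0).
- by move=> U x x'; rewrite subr0.
- by move=> U V f x; rewrite raddf0.
have pz : @functor_exact L (sval F) (sval G) (sval G) p z.
  by move=> U x; split=> _; [exact: p_surj | exact: z0].
move=> /(@DA_map_exact F G G p z A y pz).1 [x <-]; exact: DA_map0.
Qed.

Lemma DA_Hom : exists theta : forall X : lmodType L,
    nattrans (DA_fun (Defs.Hom X)) (tensor_functor o X),
  (forall X A, bijective (nat_fun (theta X) A)) /\
  forall (X Y : lmodType L) (g : linhom X Y) (A : fpMod R) z,
    nat_fun (theta Y) A
      (nat_fun (@DA_map (Defs.Hom Y) (Defs.Hom X) (hom_nattrans g)) A z) =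
    tensor_map o (linhom_id (sval A)) g (nat_fun (theta X) A z).
Proof.
have [th [th' [th'K thK thN]]] := iso_components DA_is_DA.2.
exists th; split=> [X A|X Y g A z].
  exists (nat_fun (th' X : nattrans (tensor_functor o X) (DA_fun (Defs.Hom X))) A).
    exact: (@nat_fun_cmpK _ (DA_fun (Defs.Hom X)) (tensor_functor o X)
      (th X) (th' X) A (th'K X)).
  exact: (@nat_fun_cmpK _ (tensor_functor o X) (DA_fun (Defs.Hom X))
    (th' X) (th X) A (thK X)).
have := thN X Y g.
by move=> /(congr1 (fun t : nattrans (DA_fun (Defs.Hom X)) (tensor_functor o Y) =>
  nat_fun t A z)).
Qed.

Local Notation q := (inj_cotorsion iota).

(* [DA q] is the kernel of [_ (x) L -> _ (x) I], that is the injective torsion;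
   [eps] is this identification. *)
Lemma torsion_to_DA_cotorsion theta :
  (forall X A, bijective
    (nat_fun (theta X : nattrans (DA_fun (Defs.Hom X)) (tensor_functor o X)) A)) ->
  (forall (X Y : lmodType L) (g : linhom X Y) (A : fpMod R) z,
    nat_fun (theta Y) A
      (nat_fun (@DA_map (Defs.Hom Y) (Defs.Hom X) (hom_nattrans g)) A z) =
    tensor_map o (linhom_id (sval A)) g (nat_fun (theta X) A z)) ->
  exists eps : nattrans (torsion_functor o iota) (DA_fun q),
  forall (X : lmodType L) (g : linhom L^o X)
      (h : nattrans (hom_functor X) (cotorsion_functor iota)),
    (forall (U : Mod L) (k : linhom X U),
      nat_fun h U k = cotorsion_class iota (linhom_comp k g)) ->
    forall (A : fpMod R) (a : torsion o iota (sval A)),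
    nat_fun (theta X) A (nat_fun (@DA_map (Defs.Hom X) q h) A (nat_fun eps A a)) =
    pure_tensor o (torsion_val a) (g (1 : L^o)).
Proof.
move=> theta_bij thetaN.
pose p : @hom (fpFun L) (Defs.Hom L^o) q := cotorsion_proj.
pose i : nattrans (DA_fun q) (tensor_functor o L^o) :=
  @cmp (functor_category (fpMod R) Ab) (DA_fun q) (DA_fun (Defs.Hom L^o))
    (tensor_functor o L^o) (theta L^o) (DA_map p).
have [||t tE] := @nattrans_of_fun _ (torsion_functor o iota) (tensor_functor o L^o)
    (fun A (a : torsion o iota (sval A)) => pure_tensor o (torsion_val a) (1 : L^o)).
- move=> A a b; apply: (addIr (pure_tensor o (torsion_val b) (1 : L^o))).
  by rewrite subrK -pure_tensorDl /= subrK.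
- by move=> A B f a; rewrite [RHS]tensor_map_pure.
have [||eps epsE] := nattrans_lift (i := i) (t := t).
- move=> A y iy; apply: (@DA_map_mono _ _ p A y).
    by move=> U; apply: cotorsion_classP.
  by apply: (bij_inj (theta_bij L^o A)); rewrite raddf0; exact: iy.
- move=> A a; have [th' _ th'K] := theta_bij L^o A.
  pose z := th' (pure_tensor o (torsion_val a) (1 : L^o)).
  (* For a torsion element [a], the tensor [a ⊗ 1] vanishes in [A ⊗ I]; exactness of [DA] on
     [Hom(I, _) -> Hom(L, _) -> q] then lifts it to [DA q]. *)
  have z0 : nat_fun (@DA_map (Defs.Hom I) (Defs.Hom L^o) (hom_nattrans iota)) A z = 0.
    apply: (bij_inj (theta_bij I A)); rewrite raddf0 thetaN th'K.
    by apply/eqP; exact: (torsionP a).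
  have [y yz] := (@DA_map_exact (Defs.Hom I) (Defs.Hom L^o) q (hom_nattrans iota) p A z
    cotorsion_proj_exact).1 z0.
  exists y; rewrite tE; transitivity (nat_fun (theta L^o) A z); last exact: th'K.
  by rewrite -yz.
exists eps => X g h hE A a.
(* The hypothesis on [h] factors it through [Hom(L, _)], which reduces the formula to [1 ⊗ g]
   applied to [a ⊗ 1]. *)
have -> : h = @cmp (fpFun L) (Defs.Hom X) (Defs.Hom L^o) q p (hom_nattrans g).
  by apply: nat_fun_ext => U k; rewrite hE.
rewrite DA_mapM thetaN.
have -> : nat_fun (theta L^o) A (nat_fun (DA_map p) A (nat_fun eps A a)) =
    pure_tensor o (torsion_val a) (1 : L^o) by rewrite -tE -epsE.
by rewrite tensor_map_pure.
Qed.

End Duality.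

(** * Universality of the map from torsion to [DA q] *)

Section RightAdjoint.
Context (L R : pzRingType) (o : L -> R) (o' : R -> L).
Hypotheses (oD : {morph o : x y / x + y}) (oM : forall x y, o (x * y) = o y * o x).
Hypotheses (oK : cancel o o') (o'K : cancel o' o).
Context (I : lmodType L) (iota : linhom L^o I).
Hypothesis fpI : finitely_presented_module I.
Context (DA : functor (op (fpFun L)) (AddFun R)).
Hypothesis DA_is_DA : is_DA o DA.

Local Notation q := (inj_cotorsion iota).

(** Composition with [eps] is a bijection from [Hom(F, q)] to [Hom(s, DA F)], stated as surjectivity
    and injectivity. *)
Let universal_map (eps : nattrans (torsion_functor o iota) (DA_fun DA q)) (F : fpFun L) :=
  (forall t : nattrans (torsion_functor o iota) (DA_fun DA F),
    exists h : @hom (fpFun L) F q,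
      forall A a, nat_fun (DA_map DA h) A (nat_fun eps A a) = nat_fun t A a) /\
  (forall h h' : @hom (fpFun L) F q,
    (forall A a, nat_fun (DA_map DA h) A (nat_fun eps A a) =
                 nat_fun (DA_map DA h') A (nat_fun eps A a)) -> h = h').

(** A transformation to [_ ⊗ X] is given by some [x] in [X] and comes from the class of [l |-> l x].
    If the classes of [g] and [g'] induce the same transformation, then [g 1 - g' 1 = u w] for some
    [u : I -> X], so [g - g'] factors through [iota]. *)
Lemma universal_map_Hom : exists eps, forall X : lmodType L,
  universal_map eps (Defs.Hom X).
Proof.
have [theta [theta_bij thetaN]] := DA_Hom DA_is_DA.
have [eps epsE] := torsion_to_DA_cotorsion iota DA_is_DA theta_bij thetaN.
exists eps => X; split=> [t|h h' hh'].
  pose tX : nattrans (torsion_functor o iota) (tensor_functor o X) :=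
    @cmp (functor_category (fpMod R) Ab) (torsion_functor o iota)
      (DA_fun DA (Defs.Hom X)) (tensor_functor o X) (theta X) t.
  have [x xE] := torsion_nattrans_pure oD oM oK o'K fpI tX.
  pose g : linhom L^o X := scale_hom x : {linear L^o -> X}.
  pose h : nattrans (hom_functor X) (cotorsion_functor iota) :=
    @cmp (functor_category (Mod L) Ab) (hom_functor X) (hom_functor L^o)
      (cotorsion_functor iota) (cotorsion_proj iota) (hom_nattrans g).
  exists h => A a; apply: (bij_inj (theta_bij X A)).
  transitivity (nat_fun tX A a); last by [].
  by rewrite xE (epsE X g) // /g /= /scale_hom scale1r.
have [g gE] := cotorsion_nattrans_lift h.
have [g' g'E] := cotorsion_nattrans_lift h'.
have [|u uE] := @torsion_pure_eq0 L R o o' oD oM oK o'K I iota fpI X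
    (g (1 : L^o) - g' (1 : L^o)).
  move=> B b; apply: (addIr (pure_tensor o (torsion_val b) (g' (1 : L^o)))).
  rewrite -pure_tensorDr subrK add0r.
  by rewrite -(epsE X g h gE) -(epsE X g' h' g'E) hh'.
apply: nat_fun_ext => U k; rewrite gE g'E; apply: subr0_eq; rewrite -raddfB.
apply/cotorsion_class_eq0; exists (linhom_comp k u); apply: linhom_ext => l.
have lE (V : lmodType L) (f : linhom L^o V) : f l = (l : L) *: f (1 : L^o).
  by rewrite -linearZ_LR; congr (f _); rewrite [RHS]mulr1.
by rewrite /= lE (lE _ g) (lE _ g') linearZ_LR uE -!linearB -scalerBr.
Qed.

(** Let [Hom(Y, _) -> Hom(X, _) -> F -> 0] be a presentation with maps [a] and [p]. A transformation
    [t] to [DA F], composed with [DA p], comes from some [h] on [Hom(X, _)]. Injectivity at [Y]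
    gives [h a = 0], so [h] descends to [F]; the descended map induces [t] because [DA p] is
    injective. Uniqueness follows from that at [X], [p] being an epimorphism. *)
Lemma universal_map_all : exists eps, forall F : fpFun L, universal_map eps F.
Proof.
have [eps epsP] := universal_map_Hom.
exists eps => -[F [X [Y [a [p [ap p_surj]]]]]].
pose F' : fpFun L := exist _ F (ex_intro _ X (ex_intro _ Y (ex_intro _ a
  (ex_intro _ p (conj ap p_surj))))).
pose a' : @hom (fpFun L) (Defs.Hom Y) (Defs.Hom X) := a.
pose p' : @hom (fpFun L) (Defs.Hom X) F' := p.
split=> [t|h h' hh'].
  pose tX : nattrans (torsion_functor o iota) (DA_fun DA (Defs.Hom X)) :=
    @cmp (functor_category (fpMod R) Ab) (torsion_functor o iota)
      (DA_fun DA F') (DA_fun DA (Defs.Hom X)) (DA_map DA p') t.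
  have [h hE] := (epsP X).1 tX.
  have [||z z0] := @nattrans_of_fun (Mod L) (hom_functor Y)
    (cotorsion_functor iota) (fun _ _ => 0).
  - by move=> U x x'; rewrite subr0.
  - by move=> U V f x; rewrite raddf0.
  have ha : @cmp (fpFun L) (Defs.Hom Y) (Defs.Hom X) q h a' = z.
    apply: (epsP Y).2 => A b; rewrite DA_mapM hE.
    rewrite (@DA_map0 _ _ _ _ DA_is_DA (Defs.Hom Y) q z) //.
    by apply/(@DA_map_exact _ _ _ _ DA_is_DA _ _ _ a' p') => //; eexists.
  have [//|U x px|h' h'E] :=
    @nattrans_factor _ (hom_functor X) F (cotorsion_functor iota) p h.
    have [y <-] := (ap U x).1 px.
    by rewrite -(z0 U y) -ha.
  have hE' : h = @cmp (fpFun L) (Defs.Hom X) F' q h' p'.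
    by apply: nat_fun_ext => U x; rewrite -h'E.
  exists h' => A b; apply: subr0_eq.
  apply: (@DA_map_mono _ _ _ _ DA_is_DA (Defs.Hom X) F' p') => //.
  by rewrite raddfB -DA_mapM -hE' hE subrr.
have E : @cmp (fpFun L) (Defs.Hom X) F' q h p' = @cmp (fpFun L) (Defs.Hom X) F' q h' p'.
  by apply: (epsP X).2 => A b; rewrite !DA_mapM hh'.
apply: nat_fun_ext => U y; have [x <-] := p_surj U y.
exact: (congr1 (fun t : nattrans (hom_functor X) (cotorsion_functor iota) =>
  nat_fun t U x) E).
Qed.

Lemma right_adjoint_torsion (DR : functor (op (AddFun R)) (fpFun L)) :
  right_adjoint_contra DA DR -> iso (DR (inj_torsion o iota)) q.
Proof.
move=> adj; have [eps epsP] := universal_map_all.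
apply: (@right_adjoint_contra_iso _ _ DA DR (inj_torsion o iota) q eps adj)
  => [F t|F h h' hh'].
  have [h hE] := (epsP F).1 t; exists h.
  by apply: nat_fun_ext => A a; rewrite -hE.
apply: (epsP F).2 => A a.
exact: (congr1 (fun t : nattrans (torsion_functor o iota) (DA_fun DA F) =>
  nat_fun t A a) hh').
Qed.

End RightAdjoint.

(** The same structure map and generators serve: [phi] is multiplicative into the converse ring
    because [k] is commutative, and its image is central. *)
Lemma artin_algebra_converse (Lam : pzRingType) :
  artin_algebra Lam -> artin_algebra Lam^c.
Proof.
move=> [k [phi [artin_k phiC [n [e e_gen]]]]].
have phiM : monoid_morphism (phi : k -> Lam^c).
  by split=> [|x y]; rewrite ?rmorph1 // mulrC rmorphM.
pose phi' : {rmorphism k -> Lam^c} := HB.pack (phi : k -> Lam^c)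
  (GRing.isZmodMorphism.Build k Lam^c (phi : k -> Lam^c) (raddfB phi))
  (GRing.isMonoidMorphism.Build k Lam^c (phi : k -> Lam^c) phiM).
exists k, phi'; split=> // [c x|]; first exact/esym/phiC.
exists n, e => x; have [c ->] := e_gen x; exists c.
by apply: eq_bigr => i _; apply: phiC.
Qed.

Theorem corollary5p18 (Lam : pzRingType) (artin_Lam : artin_algebra Lam) :
  (forall (I : lmodType Lam) (iota : linhom Lam^o I)
      (DA : functor (op (fpFun Lam)) (AddFun Lam^c))
      (DR : functor (op (AddFun Lam^c)) (fpFun Lam)),
    injective_envelope iota ->
    is_DA (fun l : Lam => l : Lam^c) DA -> right_adjoint_contra DA DR ->
    iso (DR (inj_torsion (fun l : Lam => l : Lam^c) iota)) (inj_cotorsion iota))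
  /\
  (forall (I : lmodType Lam^c) (iota : linhom (Lam^c)^o I)
      (DA : functor (op (fpFun Lam^c)) (AddFun Lam))
      (DR : functor (op (AddFun Lam)) (fpFun Lam^c)),
    injective_envelope iota ->
    is_DA (fun l : Lam^c => l : Lam) DA -> right_adjoint_contra DA DR ->
    iso (DR (inj_torsion (fun l : Lam^c => l : Lam) iota)) (inj_cotorsion iota)).
Proof.
split=> I iota DA DR [_ _ iota_ess] DA_is_DA adj.
  have fpI := fp_essential artin_Lam iota_ess.
  (* The identity map is an anti-isomorphism onto the converse ring by definition of its product. *)
  exact: (@right_adjoint_torsion Lam Lam^c (fun l => l) (fun l => l) _ _ _ _
    I iota fpI DA DA_is_DA DR adj).
have fpI := fp_essential (artin_algebra_converse artin_Lam) iota_ess.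
exact: (@right_adjoint_torsion Lam^c Lam (fun l => l) (fun l => l) _ _ _ _
  I iota fpI DA DA_is_DA DR adj).
Qed.
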